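(* Let $(A,\mathfrak m)$ be a complete discrete valuation ring with $\mathfrak m=(x)$ and algebraically closed residue field $k=A/\mathfrak m$. Let $\mathcal K=\mathcal K^2_f(\operatorname{proj} A)$ be the homotopy category of $2$-periodic complexes of finitely generated free $A$-modules with finite length cohomology. For $j\ge1$ let $\mathbf K(j)$ be the $2$-periodic complex with $\mathbf K(j)^n=A$ for all $n\in\mathbb Z$, $\partial^{2n+1}(t)=x^jt$ and $\partial^{2n}=0$ for all $n$. (1) Up to isomorphism, the AR-triangles of $\mathcal K$ are of the following form: $$\mathbf K(1)\to\mathbf K(2)\to\mathbf K(1)\to\mathbf K(1)[1],$$ $$\mathbf K(i)\to\mathbf K(i-1)\oplus\mathbf K(i+1)\to\mathbf K(i)\to\mathbf K(i)[1]\quad\text{for } i\ge2,$$ $$\mathbf K(1)[1]\to\mathbf K(2)[1]\to\mathbf K(1)[1]\to\mathbf K(1),$$ $$\mathbf K(i)[1]\to\mathbf K(i-1)[1]\oplus\mathbf K(i+1)[1]\to\mathbf K(i)[1]\to\mathbf K(i)\quad\text{for } i\ge2.$$ (2) The AR-quiver of $\mathcal K$ is $$\mathbf K(1)\leftrightarrows\mathbf K(2)\leftrightarrows\mathbf K(3)\leftrightarrows\cdots\leftrightarrows\mathbf K(i)\leftrightarrows\cdots$$ $$\mathbf K(1)[1]\leftrightarrows\mathbf K(2)[1]\leftrightarrows\mathbf K(3)[1]\leftrightarrows\cdots\leftrightarrows\mathbf K(i)[1]\leftrightarrows\cdots$$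
   Context: A $2$-periodic complex is a cochain complex $X$ with $X^{n+2}=X^n$ and $\partial_{n+2}=\partial_n$ for all $n\in\mathbb Z$; $2$-periodic maps are chain maps $f$ with $f_{n+2}=f_n$. Two $2$-periodic maps $f,g\colon X\to Y$ are $2$-homotopic if there are $s_n\colon X^n\to Y^{n-1}$ with $s_{n+2}=s_n$ and $f-g=\partial_Y s+s\partial_X$. $\mathcal K^2(\operatorname{proj} A)$ has as objects the $2$-periodic complexes of finitely generated free $A$-modules and as morphisms the $2$-homotopy classes of $2$-periodic maps; $\mathcal K^2_f(\operatorname{proj} A)$ is the full subcategory of complexes with finite length cohomology. Shift: $X[1]^n=X^{n+1}$, $\partial_{X[1],n}=-\partial_{X,n+1}$ (so $X[2]=X$). Cone of $f\colon X\to Y$: $\operatorname{cone}(f)^n=X^{n+1}\oplus Y^n$ with $\partial_n(x,y)=(-\partial_{X,n+1}(x),\partial_{Y,n}(y)-f_{n+1}(x))$. Exact triangles are those isomorphic to $X\xrightarrow{f}Y\xrightarrow{u}\operatorname{cone}(f)\xrightarrow{v}X[1]$, where $u_n(y)=(0,y)$, $v_n(x,y)=-x$. In a Krull-Schmidt triangulated category with shift $\Sigma$, a triangle $N\to E\to M\xrightarrow{h}\Sigma N$ is a (right) AR-triangle ending at $M$ if $M,N$ are indecomposable, $h\ne0$, and $h\circ t=0$ for every non-isomorphism $t\colon D\to M$ with $D$ indecomposable. A map $f\colon X\to Y$ is irreducible if it is neither a split monomorphism nor a split epimorphism, and whenever $f=h\circ g$, either $g$ is a split monomorphism or $h$ is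 a split epimorphism. For indecomposables $Z,X$, $\operatorname{irr}(Z,X)$ denotes the multiplicity of $Z$ in a decomposition into indecomposables of the middle term $E$ of the AR-triangle ending at $X$. The AR-quiver has as vertices the isomorphism classes of indecomposable objects, with $\operatorname{irr}(Z,X)$ arrows from $Z$ to $X$ (so there is an arrow exactly when there is an irreducible map $Z\to X$). In (2), $\leftrightarrows$ denotes exactly one arrow in each direction, and the displayed vertices and arrows are all of them. *)

(* Defs.v *)
From HB Require Import structures.
From mathcomp Require Import all_boot all_order all_algebra.
From mathcomp Require Import boolp.

Set Implicit Arguments.
Unset Strict Implicit.
Unset Printing Implicit Defensive.

Import GRing.Theory.
Local Open Scope ring_scope.

(* A discrete valuation ring with maximal ideal (x): a principal ideal domain
   whose non-units are exactly the multiples of x (so that it is local with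
   maximal ideal (x)) and which is not a field.
   Ideals of A are the submodules of the regular module A^o. *)
Record is_DVR (A : idomainType) (x : A) : Prop := {
  DVR_principal : forall I : {pred A^o}, GRing.submod_closed I ->
    exists a : A, forall b : A, b \in I <-> exists c : A, b = c * a;
  DVR_local : forall a : A, a \isn't a GRing.unit <-> exists c : A, a = c * x;
  DVR_not_field : x != 0
}.

(* (x)-adic completeness: the canonical map from A to the inverse limit of the
   quotients A/(x^n) is bijective. *)
Definition adically_complete (A : idomainType) (x : A) : Prop :=
  forall u : nat -> A,
    (forall n, exists c, u n.+1 - u n = c * x ^+ n) ->
    exists! l : A, forall n, exists c, l - u n = c * x ^+ n.

(* rho exhibits k as the residue field A/(x). *)
Definition is_residue_map (A : idomainType) (x : A) (k : fieldType)
    (rho : {rmorphism A -> k}) : Prop :=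
  (forall c : k, exists a : A, rho a = c) /\
  (forall a : A, rho a = 0 <-> exists c : A, a = c * x).

(* A vectType over a ring is a module with a chosen linear isomorphism onto
   some 'rV_n, that is, a finitely generated free module.
   A 2-periodic complex is recorded by its components in degrees 0 and 1:
   C0 (resp. C1) is the component in every even (resp. odd) degree, d0 the
   differential from even to odd degrees and d1 from odd to even degrees. *)
Record complex2 (A : idomainType) := Complex2 {
  C0 : vectType A;
  C1 : vectType A;
  d0 : {linear C0 -> C1};
  d1 : {linear C1 -> C0};
  d1d0 : forall t, d1 (d0 t) = 0;
  d0d1 : forall t, d0 (d1 t) = 0
}.

Arguments d0 {A} c.
Arguments d1 {A} c.

Record cmap (A : idomainType) (X Y : complex2 A) := CMap {
  f0 : {linear C0 X -> C0 Y};
  f1 : {linear C1 X -> C1 Y};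
  f1d0 : forall t, f1 (d0 X t) = d0 Y (f0 t);
  f0d1 : forall t, f0 (d1 X t) = d1 Y (f1 t)
}.

(* Equality of morphisms in the homotopy category. *)
Definition homotopic (A : idomainType) (X Y : complex2 A) (f g : cmap X Y) :
    Prop :=
  exists (s0 : {linear C0 X -> C1 Y}) (s1 : {linear C1 X -> C0 Y}),
    (forall t, f0 f t - f0 g t = d1 Y (s0 t) + s1 (d0 X t)) /\
    (forall t, f1 f t - f1 g t = d0 Y (s1 t) + s0 (d1 X t)).

Infix "~h" := homotopic (at level 70, no associativity).

Section Constructions.
Variable A : idomainType.
Implicit Types X Y Z : complex2 A.

Definition cid X : cmap X X :=
  @CMap A X X idfun idfun (fun=> erefl) (fun=> erefl).

Section Comp.
Variables (X Y Z : complex2 A) (g : cmap Y Z) (f : cmap X Y).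
Fact ccomp_comm0 t : (f1 g \o f1 f) (d0 X t) = d0 Z ((f0 g \o f0 f) t).
Proof. by rewrite /= !f1d0. Qed.
Fact ccomp_comm1 t : (f0 g \o f0 f) (d1 X t) = d1 Z ((f1 g \o f1 f) t).
Proof. by rewrite /= !f0d1. Qed.
Definition ccomp : cmap X Z :=
  @CMap A X Z (f0 g \o f0 f) (f1 g \o f1 f) ccomp_comm0 ccomp_comm1.
End Comp.

Section Zero.
Variables X Y : complex2 A.
Fact czero_comm0 (t : C0 X) :
  (\0 : C1 X -> C1 Y) (d0 X t) = d0 Y ((\0 : C0 X -> C0 Y) t).
Proof. by rewrite /= linear0. Qed.
Fact czero_comm1 (t : C1 X) :
  (\0 : C0 X -> C0 Y) (d1 X t) = d1 Y ((\0 : C1 X -> C1 Y) t).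
Proof. by rewrite /= linear0. Qed.
Definition czero : cmap X Y := @CMap A X Y \0 \0 czero_comm0 czero_comm1.
End Zero.

Section ZeroComplex.
Let U : vectType A := 'rV[A]_0.
Fact zero_complex_dd (t : U) : (\0 : U -> U) ((\0 : U -> U) t) = 0.
Proof. by []. Qed.
Definition zero_complex : complex2 A :=
  @Complex2 A U U \0 \0 zero_complex_dd zero_complex_dd.
End ZeroComplex.

Section Shift.
Variable X : complex2 A.
Fact shift_dd0 t : (\- d0 X) ((\- d1 X) t) = 0.
Proof. by rewrite /= linearN opprK d0d1. Qed.
Fact shift_dd1 t : (\- d1 X) ((\- d0 X) t) = 0.
Proof. by rewrite /= linearN opprK d1d0. Qed.
Definition shift : complex2 A :=
  @Complex2 A (C1 X) (C0 X) (\- d1 X) (\- d0 X) shift_dd0 shift_dd1.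
End Shift.

Section ShiftMap.
Variables (X Y : complex2 A) (f : cmap X Y).
Fact shift_map_comm0 t : f0 f (d0 (shift X) t) = d0 (shift Y) (f1 f t).
Proof. by rewrite /= linearN f0d1. Qed.
Fact shift_map_comm1 t : f1 f (d1 (shift X) t) = d1 (shift Y) (f0 f t).
Proof. by rewrite /= linearN f1d0. Qed.
Definition shift_map : cmap (shift X) (shift Y) :=
  @CMap A (shift X) (shift Y) (f1 f) (f0 f) shift_map_comm0 shift_map_comm1.
End ShiftMap.

Section DirectSum.
Variables X Y : complex2 A.
Definition dsum_d0 (t : C0 X * C0 Y) : C1 X * C1 Y := (d0 X t.1, d0 Y t.2).
Definition dsum_d1 (t : C1 X * C1 Y) : C0 X * C0 Y := (d1 X t.1, d1 Y t.2).
Fact dsum_d0_linear : linear dsum_d0.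
Proof. by move=> a u v; rewrite /dsum_d0 /= !linearP. Qed.
Fact dsum_d1_linear : linear dsum_d1.
Proof. by move=> a u v; rewrite /dsum_d1 /= !linearP. Qed.
HB.instance Definition _ :=
  GRing.isLinear.Build A (C0 X * C0 Y)%type (C1 X * C1 Y)%type *:%R
    dsum_d0 dsum_d0_linear.
HB.instance Definition _ :=
  GRing.isLinear.Build A (C1 X * C1 Y)%type (C0 X * C0 Y)%type *:%R
    dsum_d1 dsum_d1_linear.
Fact dsum_dd0 t : dsum_d1 (dsum_d0 t) = 0.
Proof. by rewrite /dsum_d1 /= !d1d0. Qed.
Fact dsum_dd1 t : dsum_d0 (dsum_d1 t) = 0.
Proof. by rewrite /dsum_d0 /= !d0d1. Qed.
Definition dsum : complex2 A :=
  @Complex2 A (C0 X * C0 Y)%type (C1 X * C1 Y)%type dsum_d0 dsum_d1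
    dsum_dd0 dsum_dd1.
End DirectSum.

Definition big_dsum (s : seq (complex2 A)) : complex2 A :=
  foldr dsum zero_complex s.

Section Cone.
Variables (X Y : complex2 A) (f : cmap X Y).
Definition cone_d0 (t : C1 X * C0 Y) : C0 X * C1 Y :=
  (- d1 X t.1, d0 Y t.2 - f1 f t.1).
Definition cone_d1 (t : C0 X * C1 Y) : C1 X * C0 Y :=
  (- d0 X t.1, d1 Y t.2 - f0 f t.1).
Fact cone_d0_linear : linear cone_d0.
Proof.
move=> a [u1 u2] [v1 v2]; rewrite /cone_d0 /= !linearP /=.
by congr (_, _); rewrite /= ?opprD ?scalerN ?scalerBr // addrACA.
Qed.
Fact cone_d1_linear : linear cone_d1.
Proof.
move=> a [u1 u2] [v1 v2]; rewrite /cone_d1 /= !linearP /=.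
by congr (_, _); rewrite /= ?opprD ?scalerN ?scalerBr // addrACA.
Qed.
HB.instance Definition _ :=
  GRing.isLinear.Build A (C1 X * C0 Y)%type (C0 X * C1 Y)%type *:%R
    cone_d0 cone_d0_linear.
HB.instance Definition _ :=
  GRing.isLinear.Build A (C0 X * C1 Y)%type (C1 X * C0 Y)%type *:%R
    cone_d1 cone_d1_linear.
Fact cone_dd0 t : cone_d1 (cone_d0 t) = 0.
Proof.
by rewrite /cone_d1 /= (linearN (d0 X)) (linearN (f0 f)) (linearB (d1 Y)) d0d1 d1d0 f0d1 !oppr0 sub0r opprK addNr.
Qed.
Fact cone_dd1 t : cone_d0 (cone_d1 t) = 0.
Proof.
by rewrite /cone_d0 /= (linearN (d1 X)) (linearN (f1 f)) (linearB (d0 Y)) d1d0 d0d1 f1d0 !oppr0 sub0r opprK addNr.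
Qed.
Definition cone : complex2 A :=
  @Complex2 A (C1 X * C0 Y)%type (C0 X * C1 Y)%type cone_d0 cone_d1
    cone_dd0 cone_dd1.

Definition cone_in0 (t : C0 Y) : C0 cone := (0, t).
Definition cone_in1 (t : C1 Y) : C1 cone := (0, t).
Fact cone_in0_linear : linear cone_in0.
Proof. by move=> a u v; congr (_, _); rewrite /= scaler0 addr0. Qed.
Fact cone_in1_linear : linear cone_in1.
Proof. by move=> a u v; congr (_, _); rewrite /= scaler0 addr0. Qed.
HB.instance Definition _ :=
  GRing.isLinear.Build A (C0 Y) (C0 cone) *:%R cone_in0 cone_in0_linear.
HB.instance Definition _ :=
  GRing.isLinear.Build A (C1 Y) (C1 cone) *:%R cone_in1 cone_in1_linear.
Fact cone_in_comm0 t : cone_in1 (d0 Y t) = d0 cone (cone_in0 t).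
Proof. by rewrite /= /cone_d0 /= (linear0 (d1 X)) (linear0 (f1 f)) oppr0 subr0. Qed.
Fact cone_in_comm1 t : cone_in0 (d1 Y t) = d1 cone (cone_in1 t).
Proof. by rewrite /= /cone_d1 /= (linear0 (d0 X)) (linear0 (f0 f)) oppr0 subr0. Qed.
Definition cone_in : cmap Y cone :=
  @CMap A Y cone cone_in0 cone_in1 cone_in_comm0 cone_in_comm1.

Definition cone_out0 (t : C0 cone) : C0 (shift X) := - t.1.
Definition cone_out1 (t : C1 cone) : C1 (shift X) := - t.1.
Fact cone_out0_linear : linear cone_out0.
Proof. by move=> a u v; rewrite /cone_out0 /= opprD scalerN. Qed.
Fact cone_out1_linear : linear cone_out1.
Proof. by move=> a u v; rewrite /cone_out1 /= opprD scalerN. Qed.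
HB.instance Definition _ :=
  GRing.isLinear.Build A (C0 cone) (C0 (shift X)) *:%R
    cone_out0 cone_out0_linear.
HB.instance Definition _ :=
  GRing.isLinear.Build A (C1 cone) (C1 (shift X)) *:%R
    cone_out1 cone_out1_linear.
Fact cone_out_comm0 t : cone_out1 (d0 cone t) = d0 (shift X) (cone_out0 t).
Proof. by rewrite /= /cone_out1 /cone_out0 /= (linearN (d1 X)). Qed.
Fact cone_out_comm1 t : cone_out0 (d1 cone t) = d1 (shift X) (cone_out1 t).
Proof. by rewrite /= /cone_out1 /cone_out0 /= (linearN (d0 X)). Qed.
Definition cone_out : cmap cone (shift X) :=
  @CMap A cone (shift X) cone_out0 cone_out1 cone_out_comm0 cone_out_comm1.
End Cone.

(* K(j), with differential x^j out of the odd degrees and 0 out of the even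
   ones. *)
Section Koszul.
Variables (x : A) (j : nat).
Definition Kosz_d1 (t : A^o) : A^o := x ^+ j * t.
Fact Kosz_d1_linear : linear Kosz_d1.
Proof. by move=> a u v; rewrite /Kosz_d1 mulrDr; congr (_ + _); apply: mulrCA. Qed.
HB.instance Definition _ :=
  GRing.isLinear.Build A A^o A^o *:%R Kosz_d1 Kosz_d1_linear.
Fact Kosz_dd0 (t : A^o) : Kosz_d1 ((\0 : A^o -> A^o) t) = 0.
Proof. exact: mulr0. Qed.
Fact Kosz_dd1 (t : A^o) : (\0 : A^o -> A^o) (Kosz_d1 t) = 0.
Proof. by []. Qed.
Definition Kosz : complex2 A :=
  @Complex2 A A^o A^o \0 Kosz_d1 Kosz_dd0 Kosz_dd1.
End Koszul.

(* The middle cohomology ker g / im f of U -> V -> W has finite length: the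
   strict chains of submodules of V lying between im f and ker g have bounded
   length. *)
Definition finite_length_cohomology (U V W : vectType A)
    (f : {linear U -> V}) (g : {linear V -> W}) : Prop :=
  exists l : nat, forall (r : nat) (M : nat -> {pred V}),
    (forall i, (i <= r)%N -> GRing.submod_closed (M i)) ->
    (forall i, (i < r)%N ->
       {subset M i <= M i.+1} /\ ~ {subset M i.+1 <= M i}) ->
    (forall u, f u \in M 0%N) ->
    (forall v, v \in M r -> g v = 0) ->
    (r <= l)%N.

(* The objects of the full subcategory K^2_f(proj A). *)
Definition in_Kf (X : complex2 A) : Prop :=
  finite_length_cohomology (d1 X) (d0 X) /\
  finite_length_cohomology (d0 X) (d1 X).

Definition is_iso (X Y : complex2 A) (f : cmap X Y) : Prop :=
  exists g : cmap Y X, ccomp g f ~h cid X /\ ccomp f g ~h cid Y.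

Definition isomorphic (X Y : complex2 A) : Prop :=
  exists f : cmap X Y, is_iso f.

Definition is_zero (X : complex2 A) : Prop := cid X ~h czero X X.

Definition split_mono (X Y : complex2 A) (f : cmap X Y) : Prop :=
  exists r : cmap Y X, ccomp r f ~h cid X.

Definition split_epi (X Y : complex2 A) (f : cmap X Y) : Prop :=
  exists s : cmap Y X, ccomp f s ~h cid Y.

Definition indecomposable (X : complex2 A) : Prop :=
  [/\ in_Kf X, ~ is_zero X &
      forall Y Z : complex2 A, in_Kf Y -> in_Kf Z ->
        isomorphic X (dsum Y Z) -> is_zero Y \/ is_zero Z].

Definition irreducible_map (X Y : complex2 A) (f : cmap X Y) : Prop :=
  [/\ ~ split_mono f, ~ split_epi f &
      forall (W : complex2 A) (g : cmap X W) (h : cmap W Y), in_Kf W ->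
        f ~h ccomp h g -> split_mono g \/ split_epi h].

Record triangle := Triangle {
  tN : complex2 A;
  tE : complex2 A;
  tM : complex2 A;
  ta : cmap tN tE;
  tb : cmap tE tM;
  th : cmap tM (shift tN)
}.

Definition cone_triangle (X Y : complex2 A) (f : cmap X Y) : triangle :=
  Triangle f (cone_in f) (cone_out f).

Definition triangle_iso (S T : triangle) : Prop :=
  exists (p : cmap (tN S) (tN T)) (q : cmap (tE S) (tE T))
         (r : cmap (tM S) (tM T)),
    [/\ is_iso p, is_iso q & is_iso r] /\
    [/\ ccomp q (ta S) ~h ccomp (ta T) p,
        ccomp r (tb S) ~h ccomp (tb T) q &
        ccomp (shift_map p) (th S) ~h ccomp (th T) r].

Definition exact_triangle (T : triangle) : Prop :=
  exists (X Y : complex2 A) (f : cmap X Y),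
    [/\ in_Kf X, in_Kf Y & triangle_iso (cone_triangle f) T].

Definition AR_triangle (T : triangle) : Prop :=
  [/\ exact_triangle T,
      indecomposable (tM T), indecomposable (tN T),
      ~ (th T ~h czero (tM T) (shift (tN T))) &
      forall (D : complex2 A) (t : cmap D (tM T)),
        indecomposable D -> ~ is_iso t ->
        ccomp (th T) t ~h czero D (shift (tN T))].

(* irr_mult Z X m: m is the multiplicity of (the isomorphism class of) Z in a
   decomposition into indecomposables of the middle term of an AR-triangle
   ending at X. *)
Definition irr_mult (Z X : complex2 A) (m : nat) : Prop :=
  exists T : triangle, [/\ AR_triangle T, tM T = X &
    exists s : seq (complex2 A),
      [/\ all (fun W => `[< indecomposable W >]) s,
          isomorphic (tE T) (big_dsum s) &
          count (fun W => `[< isomorphic W Z >]) s = m]].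

(* The vertices K(i) (e = false) and K(i)[1] (e = true) of the two rows. *)
Definition Kvertex (x : A) (e : bool) (i : nat) : complex2 A :=
  if e then shift (Kosz x i) else Kosz x i.

(* AR_form x N E M: the objects of a triangle N -> E -> M -> N[1] are those of
   one of the four families. In the last two N[1] = K(i)[2] is K(i); see
   shiftK below. *)
Inductive AR_form (x : A) : complex2 A -> complex2 A -> complex2 A -> Prop :=
| AR_form_1 : AR_form x (Kosz x 1) (Kosz x 2) (Kosz x 1)
| AR_form_i i : (2 <= i)%N ->
    AR_form x (Kosz x i) (dsum (Kosz x i.-1) (Kosz x i.+1)) (Kosz x i)
| AR_form_shift_1 :
    AR_form x (shift (Kosz x 1)) (shift (Kosz x 2)) (shift (Kosz x 1))
| AR_form_shift_i i : (2 <= i)%N ->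
    AR_form x (shift (Kosz x i))
      (dsum (shift (Kosz x i.-1)) (shift (Kosz x i.+1))) (shift (Kosz x i)).

End Constructions.

Lemma shiftK (A : idomainType) (X : complex2 A) : shift (shift X) = X.
Proof.
have oppK (U V : vectType A) (f : {linear U -> V}) :
    (\- (\- f) : U -> V) = f by apply/funext => t /=; rewrite opprK.
have lin_inj (U V : vectType A) (f g : {linear U -> V}) :
    (f : U -> V) = g -> f = g.
  case: f g => f [[cf] [cf']] [g [[cg] [cg']]] /= E; case: _ / E cg cg' => cg cg'.
  by rewrite (Prop_irrelevance cf cg) (Prop_irrelevance cf' cg').
case: X => U V d d' dd dd'; rewrite /shift /=.
pose D  : {linear U -> V} := \- (\- d).
pose D' : {linear V -> U} := \- (\- d').
have eD : D = d by apply: lin_inj; exact: oppK.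
have eD' : D' = d' by apply: lin_inj; exact: oppK.
suff H p q : @Complex2 A U V D D' p q = @Complex2 A U V d d' dd dd' by exact: H.
move: p q; rewrite eD eD' => p q.
by rewrite (Prop_irrelevance p dd) (Prop_irrelevance q dd').
Qed.

(* Main.v *)
(* In the homotopy category, every complex of finite length cohomology is a
   direct sum of complexes K(j) and K(j)[1]: an entry of least valuation of a
   nonzero differential splits off a summand of this form, and complexes
   with zero differential and finite length cohomology vanish. Maps between
   these summands are pairs of scalars modulo a power of x, so K(i) has a local
   endomorphism ring, with residue field k.
   The AR-triangle ending at K(i) is the cone triangle of the map
   ((1, x), (x, 1)) : K(i) -> K(i-1) + K(i+1), whose connecting map is the socle
   element x^(i-1) of Hom(K(i), K(i)[1]) = A/(x^i). The vanishing conditions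
   along K(i-1) -> K(i), K(i+1) -> K(i) and K(l)[1] -> K(i) force the
   connecting map of any AR-triangle ending at K(i) to be a unit multiple of it,
   and an exact triangle is determined by its connecting map. Multiplicities
   are computed by ranks of matrices of residues of endomorphisms. *)
From Pilot Require Import Defs.
From HB Require Import structures.
From mathcomp Require Import all_boot all_order all_algebra.
From mathcomp Require Import boolp ring zify.
From Stdlib Require Import Setoid Morphisms.

Set Implicit Arguments.
Unset Strict Implicit.
Unset Printing Implicit Defensive.

Import GRing.Theory.
(* boolp also exports a constant named cid. *)
Import Pilot.Defs.
Local Open Scope ring_scope.

(** * The homotopy category *)

(** The classification uses only a small part of the triangulated structure: a morphism between
    connecting maps extends to the middle terms, and the extension is invertible when its two given
    components are. The obstacle is that fillers are not unique, so fillers of inverse squares need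
    not compose to the identity; the composites differ from it by a map of square zero, which
    suffices. Uniqueness of multiplicities rests on the pairing of Hom(X, Z) with Hom(Z, X) given by
    the residue of the composite: only summands of X isomorphic to Z contribute to its rank. A map
    K(i) -> K(j) has an even scalar a and an odd scalar b with a x^i = x^j b. If i < j then x
    divides a, if i > j then x divides b; this decides which of the two is tested for being a unit.
    Since K(0) is contractible, the triangle ending at K(1) is the case n = 0 of a construction with
    middle term K(n) + K(n+2). The shifted families come from the shift functor, at the price of a
    sign on the connecting map. *)

Section MkLinear.
Variables (A : idomainType) (U V : lmodType A) (f : U -> V) (H : linear f).
(** A fresh constant carries the linear structure, so that any function with a proof of linearity
    can be bundled on the spot. *)
Definition mklin_fun : U -> V := f.
HB.instance Definition _ := GRing.isLinear.Build A U V *:%R mklin_fun H.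
Definition mklin : {linear U -> V} := mklin_fun.
End MkLinear.

Section HomotopyCategory.
Variable A : idomainType.
Implicit Types X Y Z W : complex2 A.

Lemma eq_homotopic X Y (f g : cmap X Y) :
  f0 f =1 f0 g -> f1 f =1 f1 g -> f ~h g.
Proof.
move=> e0 e1; exists (\0 : {linear _ -> _}), (\0 : {linear _ -> _}).
by split=> t; rewrite ?e0 ?e1 /= ?linear0 subrr addr0.
Qed.

Lemma homotopic_refl X Y (f : cmap X Y) : f ~h f.
Proof. exact: eq_homotopic. Qed.

Lemma homotopic_sym X Y (f g : cmap X Y) : f ~h g -> g ~h f.
Proof.
case=> s0 [s1 [h0 h1]].
exists (\- s0 : {linear _ -> _}), (\- s1 : {linear _ -> _}).
by split=> t; rewrite -opprB ?h0 ?h1 /= linearN opprD.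
Qed.

Lemma homotopic_trans X Y (f g h : cmap X Y) : f ~h g -> g ~h h -> f ~h h.
Proof.
case=> s0 [s1 [h0 h1]] [t0 [t1 [k0 k1]]].
exists (s0 \+ t0 : {linear _ -> _}), (s1 \+ t1 : {linear _ -> _}).
by split=> t /=; rewrite linearD addrACA -?h0 -?h1 -?k0 -?k1 subrKA.
Qed.

Lemma ccomp_homotopic X Y Z (g g' : cmap Y Z) (f f' : cmap X Y) :
  g ~h g' -> f ~h f' -> ccomp g f ~h ccomp g' f'.
Proof.
case=> t0 [t1 [k0 k1]] [s0 [s1 [h0 h1]]].
(* From gf - g'f' = g(f - f') + (g - g')f' comes the homotopy gs + tf'. *)
exists ((f1 g \o s0) \+ (t0 \o f0 f') : {linear _ -> _}),
  ((f0 g \o s1) \+ (t1 \o f1 f') : {linear _ -> _}).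
split=> t /=.
  rewrite -(subrK (f0 g (f0 f' t)) (f0 g (f0 f t))) -linearB h0 -addrA k0.
  by rewrite !linearD f0d1 f1d0 addrACA.
rewrite -(subrK (f1 g (f1 f' t)) (f1 g (f1 f t))) -linearB h1 -addrA k1.
by rewrite !linearD f0d1 f1d0 addrACA.
Qed.

Section Additive.
Variables X Y : complex2 A.
Implicit Types f g : cmap X Y.

Fact cadd_comm0 f g t :
  (f1 f \+ f1 g) (d0 X t) = d0 Y ((f0 f \+ f0 g) t).
Proof. by rewrite /= linearD !f1d0. Qed.
Fact cadd_comm1 f g t :
  (f0 f \+ f0 g) (d1 X t) = d1 Y ((f1 f \+ f1 g) t).
Proof. by rewrite /= linearD !f0d1. Qed.
Definition cadd f g : cmap X Y :=
  @CMap A X Y (f0 f \+ f0 g) (f1 f \+ f1 g) (cadd_comm0 f g) (cadd_comm1 f g).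

Fact copp_comm0 f t : (\- f1 f) (d0 X t) = d0 Y ((\- f0 f) t).
Proof. by rewrite /= linearN f1d0. Qed.
Fact copp_comm1 f t : (\- f0 f) (d1 X t) = d1 Y ((\- f1 f) t).
Proof. by rewrite /= linearN f0d1. Qed.
Definition copp f : cmap X Y :=
  @CMap A X Y (\- f0 f) (\- f1 f) (copp_comm0 f) (copp_comm1 f).

Lemma cadd_homotopic f f' g g' :
  f ~h f' -> g ~h g' -> cadd f g ~h cadd f' g'.
Proof.
case=> s0 [s1 [h0 h1]] [t0 [t1 [k0 k1]]].
exists (s0 \+ t0 : {linear _ -> _}), (s1 \+ t1 : {linear _ -> _}).
by split=> t /=; rewrite opprD addrACA ?h0 ?h1 ?k0 ?k1 linearD addrACA.
Qed.

Lemma copp_homotopic f f' : f ~h f' -> copp f ~h copp f'.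
Proof.
case=> s0 [s1 [h0 h1]].
exists (\- s0 : {linear _ -> _}), (\- s1 : {linear _ -> _}).
by split=> t /=; rewrite -opprD ?h0 ?h1 linearN opprD.
Qed.

End Additive.
End HomotopyCategory.

(* Homotopy is registered as a congruence, so that identities of the homotopy category can be proved
   by rewriting. *)
Add Parametric Relation (A : idomainType) (X Y : complex2 A) :
    (cmap X Y) (@homotopic A X Y)
  reflexivity proved by (@homotopic_refl A X Y)
  symmetry proved by (@homotopic_sym A X Y)
  transitivity proved by (@homotopic_trans A X Y)
  as homotopic_rel.

Add Parametric Morphism (A : idomainType) (X Y Z : complex2 A) :
    (@ccomp A X Y Z)
  with signature (@homotopic A Y Z) ==> (@homotopic A X Y) ==> (@homotopic A X Z)
  as ccomp_mor.
Proof. by move=> g g' hg f f' hf; apply: ccomp_homotopic. Qed.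

Add Parametric Morphism (A : idomainType) (X Y : complex2 A) : (@cadd A X Y)
  with signature (@homotopic A X Y) ==> (@homotopic A X Y) ==> (@homotopic A X Y)
  as cadd_mor.
Proof. by move=> g g' hg f f' hf; apply: cadd_homotopic. Qed.

Add Parametric Morphism (A : idomainType) (X Y : complex2 A) : (@copp A X Y)
  with signature (@homotopic A X Y) ==> (@homotopic A X Y)
  as copp_mor.
Proof. by move=> f f'; apply: copp_homotopic. Qed.

#[global] Hint Resolve homotopic_refl : core.

(** * Composition, isomorphisms and zero objects in the homotopy category *)

Section Isomorphisms.
Variable A : idomainType.
Implicit Types X Y Z W : complex2 A.

Lemma ccompA X Y Z W (h : cmap Z W) (g : cmap Y Z) (f : cmap X Y) :
  ccomp h (ccomp g f) ~h ccomp (ccomp h g) f.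
Proof. exact: eq_homotopic. Qed.

Lemma ccomp1f X Y (f : cmap X Y) : ccomp (cid Y) f ~h f.
Proof. exact: eq_homotopic. Qed.

Lemma ccompf1 X Y (f : cmap X Y) : ccomp f (cid X) ~h f.
Proof. exact: eq_homotopic. Qed.

Lemma ccomp0f X Y Z (f : cmap X Y) : ccomp (czero Y Z) f ~h czero X Z.
Proof. exact: eq_homotopic. Qed.

Lemma ccompf0 X Y Z (f : cmap Y Z) : ccomp f (czero X Y) ~h czero X Z.
Proof. by apply: eq_homotopic => t /=; rewrite linear0. Qed.

Lemma ccompDl X Y Z (g g' : cmap Y Z) (f : cmap X Y) :
  ccomp (cadd g g') f ~h cadd (ccomp g f) (ccomp g' f).
Proof. exact: eq_homotopic. Qed.

Lemma ccompDr X Y Z (g : cmap Y Z) (f f' : cmap X Y) :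
  ccomp g (cadd f f') ~h cadd (ccomp g f) (ccomp g f').
Proof. by apply: eq_homotopic => t /=; rewrite linearD. Qed.

Lemma ccompNl X Y Z (g : cmap Y Z) (f : cmap X Y) :
  ccomp (copp g) f ~h copp (ccomp g f).
Proof. exact: eq_homotopic. Qed.

Lemma ccompNr X Y Z (g : cmap Y Z) (f : cmap X Y) :
  ccomp g (copp f) ~h copp (ccomp g f).
Proof. by apply: eq_homotopic => t /=; rewrite linearN. Qed.

Lemma coppK X Y (f : cmap X Y) : copp (copp f) ~h f.
Proof. by apply: eq_homotopic => t /=; rewrite opprK. Qed.

Lemma copp0 X Y : copp (czero X Y) ~h czero X Y.
Proof. by apply: eq_homotopic => t /=; rewrite oppr0. Qed.

Lemma cadd0f X Y (f : cmap X Y) : cadd (czero X Y) f ~h f.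
Proof. by apply: eq_homotopic => t /=; rewrite add0r. Qed.

Lemma caddf0 X Y (f : cmap X Y) : cadd f (czero X Y) ~h f.
Proof. by apply: eq_homotopic => t /=; rewrite addr0. Qed.

Lemma csub_homotopic0 X Y (f g : cmap X Y) :
  cadd f (copp g) ~h czero X Y <-> f ~h g.
Proof.
by split=> -[s0 [s1 [h0 h1]]]; exists s0, s1; split=> t;
  rewrite -?h0 -?h1 /= subr0.
Qed.

Lemma copp_homotopic0 X Y (f : cmap X Y) :
  copp f ~h czero X Y <-> f ~h czero X Y.
Proof.
split=> [H|->]; last exact: copp0.
by rewrite -(coppK f) H copp0.
Qed.

Lemma id_iso X : is_iso (cid X).
Proof. by exists (cid X); split; exact: ccomp1f. Qed.

Lemma comp_iso X Y Z (g : cmap Y Z) (f : cmap X Y) :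
  is_iso g -> is_iso f -> is_iso (ccomp g f).
Proof.
case=> g' [g'g gg'] [f' [f'f ff']]; exists (ccomp f' g'); split.
  by rewrite -ccompA (ccompA g') g'g ccomp1f f'f.
by rewrite -ccompA (ccompA f) ff' ccomp1f gg'.
Qed.

Lemma homotopic_iso X Y (f g : cmap X Y) : f ~h g -> is_iso f -> is_iso g.
Proof. by move=> fg [f' [f'f ff']]; exists f'; rewrite -fg. Qed.

Lemma split_iso X Y (f : cmap X Y) : split_mono f -> split_epi f -> is_iso f.
Proof.
case=> r rf [s fs]; exists r; split => //.
have rs : r ~h s by rewrite -(ccompf1 r) -fs ccompA rf ccomp1f.
by rewrite rs.
Qed.

Lemma isomorphic_refl X : isomorphic X X.
Proof. by exists (cid X); exact: id_iso. Qed.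

Lemma isomorphic_sym X Y : isomorphic X Y -> isomorphic Y X.
Proof. by case=> f [g [gf fg]]; exists g, f. Qed.

Lemma isomorphic_trans Y X Z :
  isomorphic X Y -> isomorphic Y Z -> isomorphic X Z.
Proof. by case=> f hf [g hg]; exists (ccomp g f); exact: comp_iso. Qed.

Lemma iso_split_mono X Y (f : cmap X Y) : is_iso f -> split_mono f.
Proof. by case=> g [gf _]; exists g. Qed.

Lemma iso_split_epi X Y (f : cmap X Y) : is_iso f -> split_epi f.
Proof. by case=> g [_ fg]; exists g. Qed.

Lemma is_zero_source X Y (f : cmap X Y) : is_zero X -> f ~h czero X Y.
Proof. by move=> X0; rewrite -(ccompf1 f) (X0 : cid X ~h _) ccompf0. Qed.

Lemma is_zero_target X Y (f : cmap X Y) : is_zero Y -> f ~h czero X Y.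
Proof. by move=> Y0; rewrite -(ccomp1f f) (Y0 : cid Y ~h _) ccomp0f. Qed.

Lemma is_zero_retract X Y (f : cmap X Y) : split_mono f -> is_zero Y -> is_zero X.
Proof. by case=> r rf Y0; rewrite /is_zero -rf (is_zero_target f Y0) ccompf0. Qed.

Lemma is_zero_isomorphic X Y : isomorphic X Y -> is_zero X <-> is_zero Y.
Proof.
case=> f [g [gf fg]]; split.
  by apply: (@is_zero_retract _ _ g); exists f.
by apply: (@is_zero_retract _ _ f); exists g.
Qed.

End Isomorphisms.

Add Parametric Morphism (A : idomainType) (X Y : complex2 A) : (@is_iso A X Y)
  with signature (@homotopic A X Y) ==> iff as is_iso_mor.
Proof.
by move=> f g fg; split; apply: homotopic_iso => //; exact: homotopic_sym.
Qed.

(** * Shift and direct sums *)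

Section ShiftFunctor.
Variable A : idomainType.
Implicit Types X Y Z W : complex2 A.

Lemma shift_map_homotopic X Y (f g : cmap X Y) :
  f ~h g -> shift_map f ~h shift_map g.
Proof.
case=> s0 [s1 [h0 h1]].
exists (\- s1 : {linear _ -> _}), (\- s0 : {linear _ -> _}).
by split=> t /=; rewrite linearN opprK ?h0 ?h1 linearN opprK.
Qed.

Fact unshift_comm0 X Y (f : cmap (shift X) (shift Y)) t :
  f0 f (d0 X t) = d0 Y (f1 f t).
Proof.
by have /= := f0d1 f t; rewrite linearN => /oppr_inj.
Qed.
Fact unshift_comm1 X Y (f : cmap (shift X) (shift Y)) t :
  f1 f (d1 X t) = d1 Y (f0 f t).
Proof.
by have /= := f1d0 f t; rewrite linearN => /oppr_inj.
Qed.
(** The inverse of the shift on morphisms, defined directly because the signs of the two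
    differentials cancel; this avoids transporting maps along the equality [shiftK]. *)
Definition unshift X Y (f : cmap (shift X) (shift Y)) : cmap X Y :=
  @CMap A X Y (f1 f) (f0 f) (unshift_comm0 f) (unshift_comm1 f).

Lemma unshift_homotopic X Y (f g : cmap (shift X) (shift Y)) :
  f ~h g -> unshift f ~h unshift g.
Proof.
case=> s0 [s1 [/= h0 h1]].
exists (\- s1 : {linear _ -> _}), (\- s0 : {linear _ -> _}).
by split=> t /=; rewrite ?h0 ?h1 !linearN.
Qed.

Lemma unshiftK X Y (f : cmap (shift X) (shift Y)) : shift_map (unshift f) ~h f.
Proof. exact: eq_homotopic. Qed.

Lemma shift_map_comp X Y Z (g : cmap Y Z) (f : cmap X Y) :
  shift_map (ccomp g f) ~h ccomp (shift_map g) (shift_map f).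
Proof. exact: eq_homotopic. Qed.

Lemma shift_map_id X : shift_map (cid X) ~h cid (shift X).
Proof. exact: eq_homotopic. Qed.

Lemma shift_map0 X Y : shift_map (czero X Y) ~h czero (shift X) (shift Y).
Proof. exact: eq_homotopic. Qed.

Lemma shift_surj X : exists X', shift X' = X.
Proof. by exists (shift X); exact: shiftK. Qed.

Lemma shift_map_inj X Y (f g : cmap X Y) :
  shift_map f ~h shift_map g -> f ~h g.
Proof.
by move/unshift_homotopic => H; apply: homotopic_trans (homotopic_trans H _);
  apply: eq_homotopic.
Qed.

End ShiftFunctor.

Add Parametric Morphism (A : idomainType) (X Y : complex2 A) : (@shift_map A X Y)
  with signature (@homotopic A X Y) ==> (@homotopic A (shift X) (shift Y))
  as shift_map_mor.
Proof. by move=> f f'; apply: shift_map_homotopic. Qed.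

Section ShiftProperties.
Variable A : idomainType.
Implicit Types X Y Z W : complex2 A.

Lemma shift_map_split_mono X Y (f : cmap X Y) :
  split_mono (shift_map f) <-> split_mono f.
Proof.
split=> [[r rf]|[r rf]]; last first.
  by exists (shift_map r); rewrite -shift_map_comp rf shift_map_id.
exists (unshift r); apply: shift_map_inj.
by rewrite shift_map_comp unshiftK rf shift_map_id.
Qed.

Lemma shift_map_split_epi X Y (f : cmap X Y) :
  split_epi (shift_map f) <-> split_epi f.
Proof.
split=> [[r rf]|[r rf]]; last first.
  by exists (shift_map r); rewrite -shift_map_comp rf shift_map_id.
exists (unshift r); apply: shift_map_inj.
by rewrite shift_map_comp unshiftK rf shift_map_id.
Qed.

Lemma shift_map_iso X Y (f : cmap X Y) : is_iso (shift_map f) <-> is_iso f.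
Proof.
split=> H.
  apply: split_iso.
    by apply/shift_map_split_mono; exact: iso_split_mono.
  by apply/shift_map_split_epi; exact: iso_split_epi.
apply: split_iso.
  by apply/shift_map_split_mono; exact: iso_split_mono.
by apply/shift_map_split_epi; exact: iso_split_epi.
Qed.

Lemma isomorphic_shift X Y : isomorphic (shift X) (shift Y) <-> isomorphic X Y.
Proof.
split=> [[f]|[f]]; last by exists (shift_map f); apply/shift_map_iso.
move=> fi; exists (unshift f); apply/shift_map_iso.
by apply: homotopic_iso fi; rewrite unshiftK.
Qed.

Lemma is_zero_shift X : is_zero (shift X) <-> is_zero X.
Proof.
rewrite /is_zero; split=> H; last first.
  by rewrite -shift_map_id (H : cid X ~h _) shift_map0.
apply: shift_map_inj; apply: homotopic_trans H _; exact: eq_homotopic.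
Qed.

Fact shift2_comm0 X t : idfun (d0 X t) = d0 (shift (shift X)) (idfun t).
Proof. by rewrite /= opprK. Qed.
Fact shift2_comm1 X t : idfun (d1 X t) = d1 (shift (shift X)) (idfun t).
Proof. by rewrite /= opprK. Qed.
(** The equality [shiftK] as a morphism with identity components, which can be composed without a
    transport. *)
Definition shift2 X : cmap X (shift (shift X)) :=
  @CMap A X (shift (shift X)) idfun idfun (@shift2_comm0 X) (@shift2_comm1 X).

Lemma shift2_iso X : is_iso (shift2 X).
Proof.
have c0 t : idfun (d0 (shift (shift X)) t) = d0 X (idfun t).
  by rewrite /= opprK.
have c1 t : idfun (d1 (shift (shift X)) t) = d1 X (idfun t).
  by rewrite /= opprK.
by exists (@CMap A (shift (shift X)) X idfun idfun c0 c1); split; apply: eq_homotopic.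
Qed.

Lemma isomorphic_shift2 X : isomorphic X (shift (shift X)).
Proof. by exists (shift2 X); exact: shift2_iso. Qed.

Lemma finite_length_opp (U V W : vectType A) (f f' : {linear U -> V})
    (g g' : {linear V -> W}) :
  (forall u, f' u = - f u) -> (forall v, g' v = - g v) ->
  finite_length_cohomology f g -> finite_length_cohomology f' g'.
Proof.
move=> ef eg [l H]; exists l => r M sM ssM fM gM; apply: H sM ssM _ _.
  by move=> u; have := fM (- u); rewrite ef linearN opprK.
by move=> v /gM; rewrite eg => /eqP; rewrite oppr_eq0 => /eqP.
Qed.

Lemma in_Kf_shift X : in_Kf (shift X) <-> in_Kf X.
Proof.
by split=> -[h h']; split; (apply: (finite_length_opp _ _ h)
  || apply: (finite_length_opp _ _ h')) => t //=; rewrite opprK.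
Qed.

End ShiftProperties.

(** * Direct sums *)

Section DirectSums.
Variable A : idomainType.
Implicit Types X Y Z W : complex2 A.

Fact inl_linear (U V : lmodType A) : linear (fun u : U => (u, 0 : V)).
Proof. by move=> a u v; congr (_, _); rewrite /= scaler0 addr0. Qed.
Fact inr_linear (U V : lmodType A) : linear (fun v : V => (0 : U, v)).
Proof. by move=> a u v; congr (_, _); rewrite /= scaler0 addr0. Qed.
Fact fst_linear (U V : lmodType A) : linear (fun p : U * V => p.1).
Proof. by []. Qed.
Fact snd_linear (U V : lmodType A) : linear (fun p : U * V => p.2).
Proof. by []. Qed.
Definition lin_inl U V := mklin (@inl_linear U V).
Definition lin_inr U V := mklin (@inr_linear U V).
Definition lin_fst U V := mklin (@fst_linear U V).
Definition lin_snd U V := mklin (@snd_linear U V).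

Section InjProj.
Variables X Y : complex2 A.
Fact dinl_comm0 t : lin_inl _ (C1 Y) (d0 X t) = d0 (dsum X Y) (lin_inl _ _ t).
Proof. by congr (_, _); rewrite /= linear0. Qed.
Fact dinl_comm1 t : lin_inl _ (C0 Y) (d1 X t) = d1 (dsum X Y) (lin_inl _ _ t).
Proof. by congr (_, _); rewrite /= linear0. Qed.
Definition dinl : cmap X (dsum X Y) :=
  @CMap A X (dsum X Y) (lin_inl _ _) (lin_inl _ _) dinl_comm0 dinl_comm1.
Fact dinr_comm0 t : lin_inr (C1 X) _ (d0 Y t) = d0 (dsum X Y) (lin_inr _ _ t).
Proof. by congr (_, _); rewrite /= linear0. Qed.
Fact dinr_comm1 t : lin_inr (C0 X) _ (d1 Y t) = d1 (dsum X Y) (lin_inr _ _ t).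
Proof. by congr (_, _); rewrite /= linear0. Qed.
Definition dinr : cmap Y (dsum X Y) :=
  @CMap A Y (dsum X Y) (lin_inr _ _) (lin_inr _ _) dinr_comm0 dinr_comm1.
Definition dfst : cmap (dsum X Y) X :=
  @CMap A (dsum X Y) X (lin_fst _ _) (lin_fst _ _) (fun=> erefl) (fun=> erefl).
Definition dsnd : cmap (dsum X Y) Y :=
  @CMap A (dsum X Y) Y (lin_snd _ _) (lin_snd _ _) (fun=> erefl) (fun=> erefl).

Lemma dfst_inl : ccomp dfst dinl ~h cid X. Proof. exact: eq_homotopic. Qed.
Lemma dsnd_inr : ccomp dsnd dinr ~h cid Y. Proof. exact: eq_homotopic. Qed.
Lemma dfst_inr : ccomp dfst dinr ~h czero Y X. Proof. exact: eq_homotopic. Qed.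
Lemma dsnd_inl : ccomp dsnd dinl ~h czero X Y. Proof. exact: eq_homotopic. Qed.
Lemma dsum_id : cid (dsum X Y) ~h cadd (ccomp dinl dfst) (ccomp dinr dsnd).
Proof.
by apply: eq_homotopic => -[u v] /=; congr (_, _); rewrite /= ?addr0 ?add0r.
Qed.

Lemma dsum_comp W Z (h : cmap (dsum X Y) Z) (g : cmap W (dsum X Y)) :
  ccomp h g ~h cadd (ccomp (ccomp h dinl) (ccomp dfst g))
                    (ccomp (ccomp h dinr) (ccomp dsnd g)).
Proof.
rewrite -{1}(ccompf1 h) dsum_id ccompDr ccompDl.
by apply: cadd_homotopic; apply: eq_homotopic.
Qed.
End InjProj.

Definition dpair W X Y (f : cmap W X) (g : cmap W Y) : cmap W (dsum X Y) :=
  cadd (ccomp (dinl X Y) f) (ccomp (dinr X Y) g).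
Definition dcopair X Y Z (f : cmap X Z) (g : cmap Y Z) : cmap (dsum X Y) Z :=
  cadd (ccomp f (dfst X Y)) (ccomp g (dsnd X Y)).

Definition dsum_map X Y X' Y' (f : cmap X X') (g : cmap Y Y') :=
  dpair (ccomp f (dfst X Y)) (ccomp g (dsnd X Y)).

Lemma dsum_map_comp X Y X' Y' X'' Y'' (f' : cmap X' X'') (g' : cmap Y' Y'')
    (f : cmap X X') (g : cmap Y Y') :
  ccomp (dsum_map f' g') (dsum_map f g) ~h dsum_map (ccomp f' f) (ccomp g' g).
Proof.
by apply: eq_homotopic => -[u v]; congr (_, _);
  rewrite /= /mklin_fun /= ?addr0 ?add0r ?linear0 ?addr0 ?add0r.
Qed.

Lemma dsum_map_homotopic X Y X' Y' (f f' : cmap X X') (g g' : cmap Y Y') :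
  f ~h f' -> g ~h g' -> dsum_map f g ~h dsum_map f' g'.
Proof. by move=> hf hg; rewrite /dsum_map /dpair hf hg. Qed.

Lemma dsum_map_id X Y : dsum_map (cid X) (cid Y) ~h cid (dsum X Y).
Proof. by rewrite dsum_id; apply: eq_homotopic. Qed.

Lemma dsum_map_iso X Y X' Y' (f : cmap X X') (g : cmap Y Y') :
  is_iso f -> is_iso g -> is_iso (dsum_map f g).
Proof.
case=> f' [f'f ff'] [g' [g'g gg']]; exists (dsum_map f' g').
split; rewrite dsum_map_comp -dsum_map_id.
  exact: dsum_map_homotopic f'f g'g.
exact: dsum_map_homotopic ff' gg'.
Qed.

Lemma isomorphic_dsum X Y X' Y' :
  isomorphic X X' -> isomorphic Y Y' -> isomorphic (dsum X Y) (dsum X' Y').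
Proof.
by move=> [f hf] [g hg]; exists (dsum_map f g); exact: dsum_map_iso.
Qed.

Lemma dsum_zero_l_iso X Y : is_zero X -> is_iso (dsnd X Y).
Proof.
move=> X0; exists (dinr X Y); split; last exact: dsnd_inr.
by rewrite dsum_id (is_zero_source (dinl X Y) X0) ccomp0f cadd0f.
Qed.

Lemma dsum_zero_r_iso X Y : is_zero Y -> is_iso (dfst X Y).
Proof.
move=> Y0; exists (dinl X Y); split; last exact: dfst_inl.
by rewrite dsum_id (is_zero_source (dinr X Y) Y0) ccomp0f caddf0.
Qed.

Fact shift_dsum_comm0 X Y t :
  idfun (d0 (shift (dsum X Y)) t) = d0 (dsum (shift X) (shift Y)) (idfun t).
Proof. by []. Qed.
Fact shift_dsum_comm1 X Y t :
  idfun (d1 (shift (dsum X Y)) t) = d1 (dsum (shift X) (shift Y)) (idfun t).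
Proof. by []. Qed.
Fact dsum_shift_comm0 X Y t :
  idfun (d0 (dsum (shift X) (shift Y)) t) = d0 (shift (dsum X Y)) (idfun t).
Proof. by []. Qed.
Fact dsum_shift_comm1 X Y t :
  idfun (d1 (dsum (shift X) (shift Y)) t) = d1 (shift (dsum X Y)) (idfun t).
Proof. by []. Qed.
Definition shift_dsum X Y : cmap (shift (dsum X Y)) (dsum (shift X) (shift Y)) :=
  @CMap A (shift (dsum X Y)) (dsum (shift X) (shift Y)) idfun idfun
    (@shift_dsum_comm0 X Y) (@shift_dsum_comm1 X Y).
Lemma shift_dsum_iso X Y : is_iso (shift_dsum X Y).
Proof.
exists (@CMap A (dsum (shift X) (shift Y)) (shift (dsum X Y)) idfun idfun
  (@dsum_shift_comm0 X Y) (@dsum_shift_comm1 X Y)).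
by split; apply: eq_homotopic.
Qed.

Lemma zero_complex_is_zero : is_zero (zero_complex A).
Proof. by apply: eq_homotopic => t; apply/rowP => -[]. Qed.

End DirectSums.

(** * Exact triangles *)

Section Triangles.
Variable A : idomainType.
Implicit Types X Y Z W : complex2 A.

(** Rearranges the differential identity in [cone_fill] into the homotopy relation between the two
    composites. *)
Lemma sub_sub_swap (V : zmodType) (D F J Q : V) :
  - J - Q = D - F -> F - Q = D + J.
Proof.
by move=> e; rewrite -[F in LHS](addrK J) -addrA e addrC addrA subrK.
Qed.

(** The hypothesis says that the X'-component of r is p up to a homotopy s. The Y'-component of r,
    corrected by f's, is a map R that commutes with the differentials up to the term f'p on the
    X-coordinate. Restricted to Y it is the chain map q; restricted to the coordinate from X it is a
    homotopy between qf and f'p. *)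
Lemma cone_fill X Y X' Y' (f : cmap X Y) (f' : cmap X' Y') (p : cmap X X')
    (r : cmap (cone f) (cone f')) :
  ccomp (shift_map p) (cone_out f) ~h ccomp (cone_out f') r ->
  exists q : cmap Y Y', ccomp q f ~h ccomp f' p /\
    ccomp r (cone_in f) ~h ccomp (cone_in f') q.
Proof.
case=> s0 [s1 [h0 h1]].
have {}h0 z : (f0 r z).1 = f1 p z.1 - d0 X' (s0 z) + s1 (d0 (cone f) z).
  have /= := h0 z; rewrite /cone_out0 /= linearN opprK => e.
  by rewrite -addrA -e addrA subrr add0r.
have {}h1 z : (f1 r z).1 = f0 p z.1 - d1 X' (s1 z) + s0 (d1 (cone f) z).
  have /= := h1 z; rewrite /cone_out1 /= linearN opprK => e.
  by rewrite -addrA -e addrA subrr add0r.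
pose R0 : {linear C0 (cone f) -> C0 Y'} :=
  (lin_snd (C1 X') (C0 Y') \o f0 r) \+ (f0 f' \o s0).
pose R1 : {linear C1 (cone f) -> C1 Y'} :=
  (lin_snd (C0 X') (C1 Y') \o f1 r) \+ (f1 f' \o s1).
have k0 z : R1 (d0 (cone f) z) = d0 Y' (R0 z) - f1 f' (f1 p z.1).
  have /(congr1 snd) /= e := f1d0 r z.
  rewrite /R1 /R0 /= /mklin_fun e h0 (linearD (d0 Y')) (linearD (f1 f')).
  by rewrite (linearB (f1 f')) f1d0 opprD addrA subrK opprB addrA.
have k1 z : R0 (d1 (cone f) z) = d1 Y' (R1 z) - f0 f' (f0 p z.1).
  have /(congr1 snd) /= e := f0d1 r z.
  rewrite /R1 /R0 /= /mklin_fun e h1 (linearD (d1 Y')) (linearD (f0 f')).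
  by rewrite (linearB (f0 f')) f0d1 opprD addrA subrK opprB addrA.
pose q0 : {linear C0 Y -> C0 Y'} := R0 \o cone_in0 f.
pose q1 : {linear C1 Y -> C1 Y'} := R1 \o cone_in1 f.
have c0 t : q1 (d0 Y t) = d0 Y' (q0 t).
  have := k0 (cone_in0 f t); rewrite -(cone_in_comm0 f) => e; apply: (etrans e).
  by rewrite /= !linear0 addr0.
have c1 t : q0 (d1 Y t) = d1 Y' (q1 t).
  have := k1 (cone_in1 f t); rewrite -(cone_in_comm1 f) => e; apply: (etrans e).
  by rewrite /= !linear0 addr0.
exists (CMap c0 c1); split.
  apply: homotopic_sym.
  pose j0 : {linear C0 X -> C1 (cone f)} := lin_inl (C0 X) (C1 Y).
  pose j1 : {linear C1 X -> C0 (cone f)} := lin_inl (C1 X) (C0 Y).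
  exists (R1 \o j0 : {linear _ -> _}), (R0 \o j1 : {linear _ -> _}).
  have e0 t : d0 (cone f) (j1 t) = - (j0 (d1 X t)) - cone_in1 f (f1 f t).
    by rewrite /= /cone_d0 /=; congr (_, _);
      rewrite /= ?linear0 ?add0r ?oppr0 ?addr0 // sub0r.
  have e1 t : d1 (cone f) (j0 t) = - (j1 (d0 X t)) - cone_in0 f (f0 f t).
    by rewrite /= /cone_d1 /=; congr (_, _);
      rewrite /= ?linear0 ?add0r ?oppr0 ?addr0 // sub0r.
  split=> t.
    have := k1 (j0 t); rewrite e1 linearB linearN => e.
    exact: sub_sub_swap e.
  have := k0 (j1 t); rewrite e0 linearB linearN => e.
  exact: sub_sub_swap e.
(* The homotopy s on Y, placed in the X'-coordinate of the cone, cancels the X'-component of r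
   there. *)
pose T0 : {linear C0 Y -> C1 (cone f')} :=
  lin_inl (C0 X') (C1 Y') \o (s0 \o cone_in0 f).
pose T1 : {linear C1 Y -> C0 (cone f')} :=
  lin_inl (C1 X') (C0 Y') \o (s1 \o cone_in1 f).
exists T0, T1; split=> t.
  have := h0 (cone_in0 f t); rewrite -(cone_in_comm0 f) /= linear0 sub0r => e.
  rewrite /= /mklin_fun /cone_d1 /=.
  apply: injective_projections => /=; first by rewrite subr0 e.
  by rewrite linear0 sub0r opprD addrA subrr add0r addr0.
have := h1 (cone_in1 f t); rewrite -(cone_in_comm1 f) /= linear0 sub0r => e.
rewrite /= /mklin_fun /cone_d0 /=.
apply: injective_projections => /=; first by rewrite subr0 e.
by rewrite linear0 sub0r opprD addrA subrr add0r addr0.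
Qed.

(** A contraction of the composite into the cone has two coordinates: up to sign, the one in X is a
    chain map g', and the one in Y is a homotopy from g to fg'. *)
Lemma cone_exact X Y W (f : cmap X Y) (g : cmap W Y) :
  ccomp (cone_in f) g ~h czero W (cone f) ->
  exists g' : cmap W X, g ~h ccomp f g'.
Proof.
case=> s0 [s1 [h0 h1]].
have {}h0 t : (0, f0 g t) = d1 (cone f) (s0 t) + s1 (d0 W t).
  by rewrite -h0 /= subr0.
have {}h1 t : (0, f1 g t) = d0 (cone f) (s1 t) + s0 (d1 W t).
  by rewrite -h1 /= subr0.
pose a0 : {linear C0 W -> C0 X} := \- (lin_fst (C0 X) (C1 Y) \o s0).
pose a1 : {linear C1 W -> C1 X} := \- (lin_fst (C1 X) (C0 Y) \o s1).
have c0 t : a1 (d0 W t) = d0 X (a0 t).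
  have /(congr1 fst) /= e := h0 t.
  by apply/esym/eqP; rewrite /= /mklin_fun (linearN (d0 X)) -subr_eq0 opprK -e.
have c1 t : a0 (d1 W t) = d1 X (a1 t).
  have /(congr1 fst) /= e := h1 t.
  by apply/esym/eqP; rewrite /= /mklin_fun (linearN (d1 X)) -subr_eq0 opprK -e.
exists (CMap c0 c1).
exists (lin_snd (C0 X) (C1 Y) \o s0 : {linear _ -> _}),
  (lin_snd (C1 X) (C0 Y) \o s1 : {linear _ -> _}); split=> t /=.
  have /(congr1 snd) /= -> := h0 t.
  by rewrite /mklin_fun linearN opprK addrAC subrK.
have /(congr1 snd) /= -> := h1 t.
by rewrite /mklin_fun linearN opprK addrAC subrK.
Qed.

(* If e - 1 squares to zero, then 2 - e is inverse to e. *)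
Lemma cone_unipotent_iso X Y (f : cmap X Y) (e : cmap Y Y) :
  ccomp e f ~h f -> ccomp (cone_in f) e ~h cone_in f -> is_iso e.
Proof.
move=> ef ie; pose n := cadd e (copp (cid Y)).
have [g ng] : exists g, n ~h ccomp f g.
  apply: cone_exact; rewrite /n ccompDr ccompNr ie ccompf1.
  exact/csub_homotopic0.
have nn : ccomp n n ~h czero Y Y.
  rewrite {2}ng ccompA {1}/n ccompDl ccompNl ef ccomp1f.
  have -> : cadd f (copp f) ~h czero X Y by apply/csub_homotopic0.
  exact: ccomp0f.
have en : e ~h cadd (cid Y) n.
  by apply: eq_homotopic => t /=; rewrite addrC subrK.
have H1 (u : cmap Y Y) : ccomp (cadd (cid Y) (copp u)) (cadd (cid Y) u) ~h
    cadd (cid Y) (copp (ccomp u u)).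
  by apply: eq_homotopic => t /=; rewrite linearD opprD addrA addrK.
have H2 (u : cmap Y Y) : ccomp (cadd (cid Y) u) (cadd (cid Y) (copp u)) ~h
    cadd (cid Y) (copp (ccomp u u)).
  by apply: eq_homotopic => t /=; rewrite linearB addrA subrK.
have id0 : cadd (cid Y) (copp (czero Y Y)) ~h cid Y by rewrite copp0 caddf0.
by exists (cadd (cid Y) (copp n)); split; rewrite en ?H1 ?H2 nn id0.
Qed.

(** Let q fill (p, r) and q' fill the inverse pair. Each composite of q and q' fixes the map
    defining its cone and the inclusion into that cone, hence is invertible by [cone_unipotent_iso];
    so q is both a split monomorphism and a split epimorphism. *)
Lemma cone_fill_iso X Y X' Y' (f : cmap X Y) (f' : cmap X' Y') (p : cmap X X')
    (r : cmap (cone f) (cone f')) : is_iso p -> is_iso r ->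
  ccomp (shift_map p) (cone_out f) ~h ccomp (cone_out f') r ->
  exists q : cmap Y Y', [/\ is_iso q, ccomp q f ~h ccomp f' p &
    ccomp r (cone_in f) ~h ccomp (cone_in f') q].
Proof.
move=> [p' [p'p pp']] [r' [r'r rr']] hpr.
have hpr' : ccomp (shift_map p') (cone_out f') ~h ccomp (cone_out f) r'.
  rewrite -(ccompf1 (cone_out f')) -rr' (ccompA _ r) -hpr !ccompA.
  by rewrite -shift_map_comp p'p shift_map_id ccomp1f.
have [q [qf rq]] := cone_fill hpr; have [q' [qf' rq']] := cone_fill hpr'.
exists q; split => //; apply: split_iso.
  have [s [sq _]] : is_iso (ccomp q' q).
    apply: (@cone_unipotent_iso _ _ f).
      by rewrite -ccompA qf ccompA qf' -ccompA p'p ccompf1.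
    by rewrite ccompA -rq' -ccompA -rq ccompA r'r ccomp1f.
  by exists (ccomp s q'); rewrite -ccompA.
have [s [_ qs]] : is_iso (ccomp q q').
  apply: (@cone_unipotent_iso _ _ f').
    by rewrite -ccompA qf' ccompA qf -ccompA pp' ccompf1.
  by rewrite ccompA -rq -ccompA -rq' ccompA rr' ccomp1f.
by exists (ccomp q' s); rewrite ccompA.
Qed.

Lemma triangle_iso_trans (S T U : triangle A) :
  triangle_iso S T -> triangle_iso T U -> triangle_iso S U.
Proof.
move=> [p [q [r [[pi qi ri] [h1 h2 h3]]]]] [p' [q' [r' [[pi' qi' ri'] [k1 k2 k3]]]]].
exists (ccomp p' p), (ccomp q' q), (ccomp r' r); split.
  by split; apply: comp_iso.
split; rewrite ?shift_map_comp -ccompA.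
- by rewrite h1 !ccompA k1.
- by rewrite h2 !ccompA k2.
- by rewrite h3 !ccompA k3.
Qed.

Lemma square_inv X Y X' Y' (f : cmap X Y) (f' : cmap X' Y')
    (p : cmap X X') (p' : cmap X' X) (q : cmap Y Y') (q' : cmap Y' Y) :
  ccomp p p' ~h cid X' -> ccomp q' q ~h cid Y ->
  ccomp q f ~h ccomp f' p -> ccomp q' f' ~h ccomp f p'.
Proof.
move=> pp' q'q h; rewrite -(ccompf1 f') -pp' (ccompA f') -h.
by rewrite !ccompA q'q ccomp1f.
Qed.

Lemma triangle_iso_sym (S T : triangle A) : triangle_iso S T -> triangle_iso T S.
Proof.
move=> [p [q [r [[[p' [p'p pp']] [q' [q'q qq']] [r' [r'r rr']]] [h1 h2 h3]]]]].
exists p', q', r'; split.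
  by split; [exists p | exists q | exists r].
split.
- exact: square_inv h1.
- exact: square_inv h2.
- apply: square_inv h3 => //.
  by rewrite -shift_map_comp p'p shift_map_id.
Qed.

Lemma exact_triangle_iso (S T : triangle A) :
  triangle_iso S T -> exact_triangle S -> exact_triangle T.
Proof.
move=> ST [X [Y [f [hX hY fS]]]]; exists X, Y, f; split=> //.
exact: triangle_iso_trans ST.
Qed.

Lemma exact_fill_iso (S T : triangle A) (p : cmap (tN S) (tN T))
    (r : cmap (tM S) (tM T)) :
  exact_triangle S -> exact_triangle T -> is_iso p -> is_iso r ->
  ccomp (shift_map p) (th S) ~h ccomp (th T) r -> triangle_iso S T.
Proof.
move=> [X [Y [f [_ _ fS]]]] [X' [Y' [f' [_ _ fT]]]] pi ri hpr.
have [p1 [q1 [r1 [[ip1 iq1 ir1] [h11 h12 h13]]]]] := fS.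
have [p2 [q2 [r2 [[ip2 iq2 ir2] [h21 h22 h23]]]]] := triangle_iso_sym fT.
suff fF : triangle_iso (cone_triangle f) (cone_triangle f').
  apply: triangle_iso_trans (triangle_iso_sym fS) _.
  exact: triangle_iso_trans fF fT.
pose p' := ccomp p2 (ccomp p p1); pose r' := ccomp r2 (ccomp r r1).
have ip' : is_iso p' by do 2![apply: comp_iso => //].
have ir' : is_iso r' by do 2![apply: comp_iso => //].
have hpr' : ccomp (shift_map p') (cone_out f) ~h ccomp (cone_out f') r'.
  rewrite /p' /r' !shift_map_comp -!ccompA h13 (ccompA (shift_map p)) hpr.
  by rewrite -(ccompA (th T)) (ccompA (shift_map p2)) h23 -ccompA.
have [q [iq qf rq]] := cone_fill_iso ip' ir' hpr'.
by exists p', q, r'.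
Qed.

End Triangles.

(** * Finite length cohomology *)

Section FiniteLength.
Variable A : idomainType.
Implicit Types X Y Z W : complex2 A.

(** A chain between im a and ker b is pulled back along g inside ker b'. Strict inclusions stay
    strict because on ker b the composite gf differs from the identity by elements of im a, which
    lie in every term of the chain. *)
Lemma finite_length_retract (U V W U' V' W' : vectType A)
    (a : {linear U -> V}) (b : {linear V -> W})
    (a' : {linear U' -> V'}) (b' : {linear V' -> W'})
    (f : {linear V -> V'}) (g : {linear V' -> V}) :
  (forall u, b' (a' u) = 0) ->
  (forall v, b v = 0 -> b' (f v) = 0) ->
  (forall u', exists u, g (a' u') = a u) ->
  (forall v, b v = 0 -> exists u, g (f v) - v = a u) ->
  finite_length_cohomology a' b' -> finite_length_cohomology a b.
Proof.
move=> ba' hf hg hgf [l H]; exists l => r M sM ssM aM Mb.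
have MS i j : (i <= j <= r)%N -> {subset M i <= M j}.
  case/andP; elim: j => [|j IH]; first by rewrite leqn0 => /eqP -> _ v.
  rewrite leq_eqVlt => /orP[/eqP -> _ v //|ij] jr v vM.
  by case: (ssM j jr) => + _; apply; exact: IH (ltnW jr) _ _.
have aMi i u : (i <= r)%N -> a u \in M i by move=> ir; exact: (MS 0%N i) (aM u).
have Mbi i v : (i <= r)%N -> v \in M i -> b v = 0.
  by move=> ir vM; apply: Mb; apply: (MS i r) vM; rewrite ir leqnn.
pose M' i : {pred V'} := [pred v' | `[< b' v' = 0 /\ g v' \in M i >]].
have M'E i v' : v' \in M' i <-> b' v' = 0 /\ g v' \in M i.
  by rewrite inE; split=> [/asboolP|?]; [|apply/asboolP].
have fgM i v : (i <= r)%N -> b v = 0 -> g (f v) \in M i <-> v \in M i.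
  move=> ir bv; have [u gu] := hgf v bv.
  have [M0 ML] := sM i ir; split=> vM.
    rewrite -[v](subKr (g (f v))) gu.
    by have := ML (-1) _ _ (aMi i u ir) vM; rewrite scaleN1r addrC.
  rewrite -[g _](subrK v) gu.
  by have := ML 1 _ _ (aMi i u ir) vM; rewrite scale1r.
apply: (H r M').
- move=> i ir; have [M0 ML] := sM i ir; split.
    by apply/M'E; rewrite !linear0.
  move=> c u v /M'E[bu gu] /M'E[bv gv]; apply/M'E.
  by rewrite !linearP bu bv scaler0 addr0; split=> //; exact: ML.
- move=> i ir; have [iS nS] := ssM i ir; split=> [v /M'E[bv /iS gv]|hS].
    exact/M'E.
  apply: nS => v vM; have bv := Mbi _ _ ir vM.
  have /hS/M'E[_] : f v \in M' i.+1 by apply/M'E; split; [exact: hf | exact/fgM].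
  by move/fgM; apply; first exact: ltnW.
- by move=> u'; apply/M'E; split; [exact: ba' | have [u ->] := hg u'].
- by move=> v' /M'E[].
Qed.

Lemma in_Kf_retract X Y (f : cmap X Y) : split_mono f -> in_Kf Y -> in_Kf X.
Proof.
case=> g [s0 [s1 [h0 h1]]] [H0 H1]; split.
  apply: (@finite_length_retract _ _ _ _ _ _ _ _ _ _ (f0 f) (f0 g) _ _ _ _ H0).
  - exact: d0d1.
  - by move=> v dv; rewrite -f1d0 dv linear0.
  - by move=> u'; exists (f1 g u'); rewrite f0d1.
  - by move=> v dv; exists (s0 v); rewrite (h0 v) dv linear0 addr0.
apply: (@finite_length_retract _ _ _ _ _ _ _ _ _ _ (f1 f) (f1 g) _ _ _ _ H1).
- exact: d1d0.
- by move=> v dv; rewrite -f0d1 dv linear0.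
- by move=> u'; exists (f0 g u'); rewrite f1d0.
- by move=> v dv; exists (s1 v); rewrite (h1 v) dv linear0 addr0.
Qed.

Lemma in_Kf_isomorphic X Y : isomorphic X Y -> in_Kf Y -> in_Kf X.
Proof. by case=> f /iso_split_mono; exact: in_Kf_retract. Qed.

(** Repeated terms are dropped, and c counts the strict steps that remain. This serves direct sums,
    where a strict chain induces chains in the two summands that may stall. *)
Lemma strict_subchain (V : lmodType A) r (M : nat -> {pred V}) :
  (forall i, (i <= r)%N -> GRing.submod_closed (M i)) ->
  (forall i, (i < r)%N -> {subset M i <= M i.+1}) ->
  exists N : nat -> {pred V},
    let c := (\sum_(0 <= i < r) `[< ~ {subset M i.+1 <= M i} >])%N in
    [/\ forall i, (i <= c)%N -> GRing.submod_closed (N i),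
        forall i, (i < c)%N -> {subset N i <= N i.+1} /\ ~ {subset N i.+1 <= N i},
        {subset M 0%N <= N 0%N} & N c =i M r].
Proof.
elim: r => [|r IH] sM MS.
  by exists M; rewrite big_nil; split.
have [i ir|i ir|N [sN NS M0 NM]] := IH.
- exact: sM (leqW ir).
- exact: MS (leqW ir).
rewrite big_nat_recr //=; set c := (\sum_(0 <= i < r) _)%N in NM NS sN *.
case: asboolP => [str|/contrapT nstr]; last first.
  exists N; rewrite addn0; split=> // v; rewrite NM; apply/idP/idP.
    exact: (MS r (ltnSn r)).
  exact: nstr.
exists (fun i => if (i <= c)%N then N i else M r.+1); rewrite addn1; split=> [i|i|//|].
- by case: ifP => [ic _|_ _]; [exact: sN | exact: sM].
- rewrite ltnS leq_eqVlt => /orP[/eqP ->|ic]; last first.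
    by rewrite ic orbT; exact: NS.
  rewrite eqxx ltnn; split=> [v|]; first by rewrite NM; exact: MS.
  by move=> H; apply: str => v /H; rewrite NM.
- by move=> v; rewrite ltnn.
Qed.

Lemma finite_length_weak (U V W : vectType A) (a : {linear U -> V})
    (b : {linear V -> W}) : finite_length_cohomology a b ->
  exists l, forall r (M : nat -> {pred V}),
    (forall i, (i <= r)%N -> GRing.submod_closed (M i)) ->
    (forall i, (i < r)%N -> {subset M i <= M i.+1}) ->
    (forall u, a u \in M 0%N) -> (forall v, v \in M r -> b v = 0) ->
    ((\sum_(0 <= i < r) `[< ~ {subset M i.+1 <= M i} >])%N <= l)%N.
Proof.
case=> l H; exists l => r M sM MS aM Mb.
have [N [sN NS N0 Nr]] := strict_subchain sM MS.
by apply: H sN NS _ _ => [u|v]; [apply: N0 | rewrite Nr; apply: Mb].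
Qed.

(** At each strict step of a chain in V x V', the intersection with V ([M1]) or the projection to V'
    ([M2]) grows strictly, so the length is at most the sum of the two numbers of strict steps. *)
Lemma finite_length_pair (U V W U' V' W' : vectType A)
    (a : {linear U -> V}) (b : {linear V -> W})
    (a' : {linear U' -> V'}) (b' : {linear V' -> W'})
    (a2 : {linear (U * U')%type -> (V * V')%type})
    (b2 : {linear (V * V')%type -> (W * W')%type}) :
  (forall u, a2 u = (a u.1, a' u.2)) -> (forall v, b2 v = (b v.1, b' v.2)) ->
  finite_length_cohomology a b -> finite_length_cohomology a' b' ->
  finite_length_cohomology a2 b2.
Proof.
move=> ea eb /finite_length_weak[l H] /finite_length_weak[l' H'].
exists (l + l')%N => r M sM ssM aM Mb.
pose M1 i : {pred V} := [pred v | (v, 0) \in M i].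
pose M2 i : {pred V'} := [pred v' | `[< exists v, (v, v') \in M i >]].
have M1E i v : (v \in M1 i) = ((v, 0) \in M i) by [].
have M2P i v' : v' \in M2 i <-> exists v, (v, v') \in M i.
  by rewrite inE; split=> [/asboolP|?]; [|apply/asboolP].
have {}H : ((\sum_(0 <= i < r) `[< ~ {subset M1 i.+1 <= M1 i} >])%N <= l)%N.
  apply: H => [i ir|i ir v|u|v].
  - have [M0 ML] := sM i ir; split; first by rewrite M1E.
    move=> c u v; rewrite !M1E => uM vM.
    suff <- : c *: (u, 0) + (v, 0) = (c *: u + v, 0) :> V * V' by exact: ML.
    by congr (_, _); rewrite /= scaler0 addr0.
  - rewrite !M1E; have [iS _] := ssM i ir. exact: iS.
  - by have := aM (u, 0); rewrite ea /= linear0 M1E.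
  - by rewrite M1E => /Mb; rewrite eb => /(congr1 fst).
have {}H' : ((\sum_(0 <= i < r) `[< ~ {subset M2 i.+1 <= M2 i} >])%N <= l')%N.
  apply: H' => [i ir|i ir v|u|v].
  - have [M0 ML] := sM i ir; split; first by apply/M2P; exists 0.
    move=> c u v /M2P[u' uM] /M2P[v' vM]; apply/M2P; exists (c *: u' + v').
    exact: ML c _ _ uM vM.
  - move=> /M2P[u uM]; apply/M2P; exists u.
    by have [iS _] := ssM i ir; exact: iS.
  - by apply/M2P; exists 0; have := aM (0, u); rewrite ea /= linear0.
  - by move=> /M2P[u /Mb]; rewrite eb => /(congr1 snd).
apply: leq_trans (leq_add H H'); rewrite -big_split /= -{1}[r]muln1.
rewrite -{1}[r]subn0 -sum_nat_const_nat; rewrite !big_mkord.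
apply: leq_sum => -[i ir] _ /=.
case: asboolP => // /contrapT S1; case: asboolP => // /contrapT S2.
(* If neither grows, an element of the larger term has the same V'-coordinate as some element of the
   smaller one; their difference lies in V, hence in the smaller term as well. *)
have [iS nS] := ssM i ir; case: nS => -[v v'] vM.
have [w wM] : exists w, (w, v') \in M i.
  by apply/M2P; apply: S2; apply/M2P; exists v.
have [M0 ML] := sM _ ir; have [M0' ML'] := sM _ (ltnW ir).
have vw : (v - w, 0) \in M i.
  apply: S1; rewrite M1E.
  suff <- : (-1) *: (w, v') + (v, v') = (v - w, 0) :> V * V'.
    by apply: ML => //; exact: iS.
  by congr (_, _); rewrite /= scaleN1r ?addNr // addrC.
suff <- : 1 *: (v - w, 0) + (w, v') = (v, v') :> V * V' by exact: ML'.
by congr (_, _); rewrite /= ?scaler0 ?add0r // scale1r subrK.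
Qed.

Lemma in_Kf_dsum X Y : in_Kf X -> in_Kf Y -> in_Kf (dsum X Y).
Proof.
by move=> [X0 X1] [Y0 Y1]; split;
  [exact: finite_length_pair X0 Y0 | exact: finite_length_pair X1 Y1].
Qed.

End FiniteLength.

(** * Decomposition into the complexes K(j) and K(j)[1] *)

Section Coordinates.
Import VectorInternalTheory.

(* Over a ring that is not a field, the chosen isomorphism of a vectType with
   'rV is only exported as an internal, semilinear map. *)
Lemma coordinates (A : idomainType) (V : vectType A) :
  exists (c : {linear V -> 'rV[A]_(dim V)}) (r : {linear 'rV[A]_(dim V) -> V}),
    cancel c r /\ cancel r c.
Proof.
have cl : linear (v2r : V -> 'rV[A]_(dim V)).
  move=> a u v; have [hZ hD] := v2r_semilinear (v2r_subproof V).
  by rewrite /v2r hD hZ.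
have rl : linear (r2v : 'rV[A]_(dim V) -> V).
  by move=> a u v; apply: (can_inj v2rK); rewrite cl !r2vK.
by exists (mklin cl), (mklin rl); split; [exact: v2rK | exact: r2vK].
Qed.
End Coordinates.

(** * Divisibility by powers of x, and splitting off a summand *)

Section Valuation.
Variables (A : idomainType) (x : A).
Hypotheses (hDVR : is_DVR x) (hcomplete : adically_complete x).

Lemma unit_or_multiple (a : A) : a \is a GRing.unit \/ exists c, a = c * x.
Proof.
case: (boolP (a \is a GRing.unit)) => [|/(DVR_local hDVR)]; first by left.
by right.
Qed.

Lemma multiple_nonunit (c : A) : (c * x) \is a GRing.unit = false.
Proof. by apply/negbTE/(DVR_local hDVR); exists c. Qed.

Lemma expx_neq0 n : x ^+ n != 0.
Proof. by rewrite expf_neq0 // (DVR_not_field hDVR). Qed.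

(* By the uniqueness of limits, 0 is the only element divisible by every power
   of x. *)
Lemma valuation (a : A) : a != 0 ->
  exists n u, u \is a GRing.unit /\ a = u * x ^+ n.
Proof.
move=> a0; apply: contrapT => H.
have div n : exists c, a = c * x ^+ n.
  elim: n => [|n [c ac]]; first by exists a; rewrite mulr1.
  case: (unit_or_multiple c) => [cu|[d cd]]; last first.
    by exists d; rewrite exprS mulrA -cd.
  by case: H; exists n, c.
have [n|l [_ lu]] := hcomplete (u := fun=> 0).
  by exists 0; rewrite subrr mul0r.
have l0 : l = 0 by apply: lu => n; exists 0; rewrite subrr mul0r.
have la : l = a by apply: lu => n; rewrite subr0; exact: div.
by rewrite -la l0 eqxx in a0.
Qed.

Lemma valuation_le (u c : A) m n : u \is a GRing.unit ->
  u * x ^+ m = c * x ^+ n -> (n <= m)%N.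
Proof.
move=> uu e; rewrite leqNgt; apply/negP => mn.
have := multiple_nonunit (c * x ^+ (n - m.+1)).
rewrite -mulrA -exprSr -subSn // subSS.
suff <- : u = c * x ^+ (n - m) by rewrite uu.
apply: (mulIf (expx_neq0 m)).
by rewrite -mulrA -exprD subnK // ltnW.
Qed.

Lemma vect_scale_eq0 (V : vectType A) (a : A) (v : V) :
  a != 0 -> a *: v = 0 -> v = 0.
Proof.
move=> a0 av; have [c [r [cK _]]] := coordinates V; apply: (can_inj cK).
apply/rowP => i; rewrite linear0 mxE; apply: (mulfI a0).
by have /(congr1 (fun w : 'rV_ _ => w 0 i)) := congr1 c av;
  rewrite linearZ linear0 !mxE mulr0.
Qed.

Lemma in_Kf_Kosz j : in_Kf (Kosz x j).
Proof.
split.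
  exists j => r M sM ssM dM _.
  (* The chain starts above x^j, and each strict step brings in a strictly smaller power of x. The
     other cohomology vanishes because multiplication by x^j is injective. *)
  suff [m [mr _]] : exists m, (m + r <= j)%N /\ x ^+ m \in M r.
    by apply: leq_trans mr; exact: leq_addl.
  elim: {-2}r (leqnn r) => [|i IH] ir.
    by exists j; rewrite addn0; split=> //; have := dM 1; rewrite /= /Kosz_d1 mulr1.
  have [m [mj mM]] := IH (ltnW ir); have [iS nS] := ssM i ir.
  have [a [aM aN]] : exists a, a \in M i.+1 /\ ~ a \in M i.
    apply: contrapT => H; apply: nS => a aM; apply: contrapT => aN.
    by apply: H; exists a.
  have [M0 ML] := sM i (ltnW ir); have [M0' ML'] := sM _ ir.
  have [|n [u [uu au]]] := @valuation a.
    by apply/eqP => a0; apply: aN; rewrite a0.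
  exists n; split; last first.
    have := ML' u^-1 _ _ aM M0'.
    by rewrite addr0 au /GRing.scale /= mulKr.
  apply: leq_trans mj; rewrite addnS ltn_add2r ltnNge; apply/negP => mn.
  apply: aN; have := ML (u * x ^+ (n - m)) _ _ mM M0.
  by rewrite addr0 /GRing.scale /= -mulrA -exprD subnK // -au.
exists 0%N => r M sM ssM dM Mb; case: r sM ssM Mb => // r sM ssM Mb.
have [_ []] := ssM 0%N isT; move=> v vM.
suff -> : v = 0 by case: (sM 0%N isT).
have MS i : (i <= r)%N -> v \in M i.+1.
  elim: i => // i IH ir; have [iS _] := ssM i.+1 ir.
  by apply: iS; apply: IH; exact: ltnW.
have /eqP := Mb v (MS r (leqnn r)); rewrite /= /Kosz_d1 mulf_eq0.
by rewrite (negbTE (expx_neq0 j)) => /eqP.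
Qed.

Lemma in_Kf_Kvertex e j : in_Kf (Kvertex x e j).
Proof. by case: e; [apply/in_Kf_shift|]; exact: in_Kf_Kosz. Qed.

(** For v nonzero, the submodules generated by x^(l+1) v, ..., x v, v form a strict chain of length
    l+1: an equality of neighbours would make some (1 - cx) x^m kill v, while 1 - cx is nonzero and
    V is torsion-free. *)
Lemma finite_length_zero_maps (U V W : vectType A) (a : {linear U -> V})
    (b : {linear V -> W}) : (forall u, a u = 0) -> (forall v, b v = 0) ->
  finite_length_cohomology a b -> forall v : V, v = 0.
Proof.
move=> a0 b0 [l H] v; apply: contrapT => v0.
pose M i : {pred V} :=
  [pred w | `[< exists c, w = (c * x ^+ (l.+1 - i)) *: v >]].
suff : (l.+1 <= l)%N by rewrite ltnn.
apply: (H l.+1 M) => [i il|i il|u|w _]; last exact: b0.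
- split; first by rewrite inE; apply/asboolP; exists 0; rewrite mul0r scale0r.
  move=> c u w; rewrite !inE => /asboolP[d ->] /asboolP[d' ->]; apply/asboolP.
  by exists (c * d + d'); rewrite scalerA -scalerDl mulrDl mulrA.
- split=> [w|H1].
    rewrite !inE => /asboolP[d ->]; apply/asboolP; exists (d * x).
    by rewrite -mulrA -exprS -subSn.
  have /H1 : (x ^+ (l.+1 - i.+1)) *: v \in M i.+1.
    by rewrite inE; apply/asboolP; exists 1; rewrite mul1r.
  rewrite inE => /asboolP[c]; rewrite (subSn (il : (i <= l)%N)) subSS exprSr.
  move/eqP; rewrite -subr_eq0 -scalerBl => /eqP e; apply: v0.
  apply: vect_scale_eq0 e; rewrite mulrA -{1}[x ^+ _]mul1r mulrAC -mulrBl.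
  rewrite mulf_neq0 ?expx_neq0 // subr_eq0; apply/eqP => e.
  by have := multiple_nonunit c; rewrite -e unitr1.
- by rewrite a0 inE; apply/asboolP; exists 0; rewrite mul0r scale0r.
Qed.

(** Here V is the sum of ker phi and A v0, and the point is an explicit basis of the kernel. Some
    basis vector p of V has a unit value under phi, since otherwise phi v0 = 1 would lie in (x). The
    other basis vectors, corrected by multiples of the p-th one, form the basis. *)
Lemma surjection_kernel_free (V : vectType A) (phi : {linear V -> A^o}) (v0 : V) :
  phi v0 = 1 -> exists n (i : {linear 'rV[A]_n -> V}) (r : {linear V -> 'rV[A]_n}),
    [/\ dim V = n.+1, forall t, r (i t) = t, forall t, phi (i t) = 0,
        r v0 = 0 & forall v, i (r v) = v - phi v *: v0].
Proof.
have [c [d [cK dK]]] := coordinates V; move: (dim V) c d cK dK => m c d cK dK phi0.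
have [p pu] : exists p, phi (d (delta_mx 0 p)) \is a GRing.unit.
  apply: contrapT => H.
  suff [a ea] : exists a, phi v0 = a * x.
    by have := multiple_nonunit a; rewrite -ea phi0 unitr1.
  have /choice[a ea] p : exists a, phi (d (delta_mx 0 p)) = a * x.
    have [pu|//] := unit_or_multiple (phi (d (delta_mx 0 p))).
    by case: H; exists p.
  exists (\sum_p c v0 0 p * a p); rewrite -(cK v0) {1}[c v0]row_sum_delta.
  rewrite !linear_sum mulr_suml; apply: eq_bigr => p _.
  by rewrite !linearZ /= ea dK /GRing.scale /= mulrA.
case: m p c d cK dK pu => [[//]|n] p c d cK dK pu.
pose cp := phi (d (delta_mx 0 p)).
pose emb (t : 'rV[A]_n) : 'rV[A]_n.+1 :=
  \row_k (if unlift p k is Some k' then t 0 k' else 0).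
have embl : linear emb.
  move=> a u v; apply/rowP => k; rewrite !mxE.
  by case: unliftP => *; rewrite ?mxE // mulr0 addr0.
have embK t : col' p (emb t) = t by apply/rowP => k; rewrite !mxE liftK.
have deltaK : col' p (delta_mx 0 p) = 0 :> 'rV[A]_n.
  by apply/rowP => k; rewrite !mxE eqxx /= eq_sym (negbTE (neq_lift _ _)).
have splitE v : v = emb (col' p v) + v 0 p *: delta_mx 0 p.
  apply/rowP => k; rewrite !mxE; case: unliftP => [k'|] ->.
    by rewrite !mxE eqxx /= eq_sym (negbTE (neq_lift _ _)) mulr0 addr0.
  by rewrite !eqxx mulr1 add0r.
pose i0 t := d (emb t) - (cp^-1 * phi (d (emb t))) *: d (delta_mx 0 p).
have i0l : linear i0.
  move=> a u v; rewrite /i0 embl (linearP d) (linearP phi) /=.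
  rewrite mulrDr scalerDl scalerBr opprD addrACA; congr (_ - _ + _).
  by rewrite scalerA /GRing.scale /= mulrCA.
(* Projection to the kernel along v0, followed by forgetting the p-th coordinate, which on the
   kernel is determined by the others. *)
pose r0 v := col' p (c (v - phi v *: v0)).
have r0l : linear r0.
  move=> a u v; rewrite /r0 -!linearP /=; congr (col' p (c _)).
  rewrite linearP scalerDl scalerBr opprD addrACA; congr (_ - _ + _).
  by rewrite scalerA.
have phii t : phi (i0 t) = 0.
  rewrite /i0 !linearB !linearZ /= -/cp /GRing.scale /=.
  by rewrite mulrN mulrAC mulVr // mul1r subrr.
have ri t : r0 (i0 t) = t.
  rewrite /r0 phii scale0r subr0 /i0 linearB linearZ !dK linearB linearZ /=.
  by rewrite deltaK embK scaler0 subr0.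
have ir v : i0 (r0 v) = v - phi v *: v0.
  rewrite /r0; set w := v - _.
  have phiw : phi w = 0 by rewrite linearB linearZ /= phi0 /GRing.scale /= mulr1 subrr.
  have dw : w = d (emb (col' p (c w))) + c w 0 p *: d (delta_mx 0 p).
    by rewrite -{1}(cK w) {1}(splitE (c w)) linearD linearZ.
  have := phiw; rewrite [in phi w]dw linearD linearZ /= -/cp.
  move/eqP; rewrite addr_eq0 /i0 [RHS]dw => /eqP ->.
  rewrite {1}/GRing.scale /= mulrN mulrCA mulVr // mulr1. by rewrite -scaleNr opprK.
exists n, (mklin i0l), (mklin r0l); split => //.
by rewrite /= /mklin_fun /r0 phi0 scale1r subrr !linear0.
Qed.

(** If j is the least valuation of an entry of the matrix D of d, attained at (i0, l0), then D = x^j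
    M with a unit u at that place of M. So e is the i0-th basis vector, w the i0-th row of M, and p,
    q are the l0-th coordinates of vM and w, divided by u. *)
Lemma pivot (V W : vectType A) (d : {linear V -> W}) : (exists v, d v != 0) ->
  exists j e w (p : {linear V -> A^o}) (q : {linear W -> A^o}),
    [/\ d e = x ^+ j *: w, p e = 1, q w = 1 & forall v, q (d v) = x ^+ j * p v].
Proof.
case=> v dv; have [cV [rV [cVK rVK]]] := coordinates V.
have [cW [rW [cWK rWK]]] := coordinates W.
pose D := lin1_mx (cW \o d \o rV).
have DE u : cW (d u) = cV u *m D by rewrite mul_rV_lin1 /= cVK.
clearbody D.
pose P n := `[< exists i l u, u \is a GRing.unit /\ D i l = u * x ^+ n >].
have exP : exists n, P n.
  have [i [l Dil]] : exists i l, D i l != 0.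
    apply: contrapT => H; case/eqP: dv; apply: (can_inj cWK).
    rewrite linear0 DE; suff -> : D = 0 by rewrite mulmx0.
    apply/matrixP => i l; rewrite [RHS]mxE; apply/eqP; apply: contrapT => /negP Dil.
    by case: H; exists i, l.
  have [n [u [uu e]]] := valuation Dil.
  by exists n; apply/asboolP; exists i, l, u.
case: (ex_minnP exP) => j /asboolP[i0 [l0 [u [uu Du]]]] jmin.
have /choice[C CE] (il : _ * _) : exists c, D il.1 il.2 = c * x ^+ j.
  have [->|Dil] := eqVneq (D il.1 il.2) 0; first by exists 0; rewrite mul0r.
  have [n [u' [uu' e]]] := valuation Dil.
  have jn : (j <= n)%N by apply: jmin; apply/asboolP; exists il.1, il.2, u'.
  by exists (u' * x ^+ (n - j)); rewrite -mulrA -exprD subnK.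
pose M := \matrix_(i, l) C (i, l).
have DM : D = x ^+ j *: M.
  by apply/matrixP => i l; rewrite !mxE mulrC -(CE (i, l)).
clearbody M.
have Mu : M i0 l0 = u.
  by apply: (mulIf (expx_neq0 j)); rewrite -Du DM !mxE mulrC.
pose p0 v := u^-1 * (cV v *m M) 0 l0; pose q0 w := u^-1 * cW w 0 l0.
have p0l : linear (p0 : V -> A^o).
  move=> a s t; rewrite /p0 linearP mulmxDl -scalemxAl !mxE mulrDr; congr (_ + _).
  by rewrite /GRing.scale /= mulrCA.
have q0l : linear (q0 : W -> A^o).
  move=> a s t; rewrite /q0 linearP !mxE mulrDr; congr (_ + _).
  by rewrite /GRing.scale /= mulrCA.
exists j, (rV (delta_mx 0 i0)), (rW (row i0 M)), (mklin p0l), (mklin q0l).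
rewrite /= /mklin_fun /p0 /q0 rVK rWK -rowE !mxE Mu mulVr //; split=> //.
  by apply: (can_inj cWK); rewrite linearZ /= DE rVK rWK DM -scalemxAr -rowE.
by move=> t; rewrite DE DM -scalemxAr !mxE mulrCA.
Qed.

(** As p i is the identity strictly and not only up to homotopy, the kernel of p is a complement of
    K in each degree and is stable under the differentials. The loss of rank drives the induction in
    [decomposition]. *)
Lemma split_off (X : complex2 A) (e0 e1 : {linear A^o -> A^o}) dd0 dd1
    (K := @Complex2 A A^o A^o e0 e1 dd0 dd1) (i : cmap K X) (p : cmap X K) :
  (forall t, f0 p (f0 i t) = t) -> (forall t, f1 p (f1 i t) = t) ->
  exists X', [/\ isomorphic X (dsum K X'), (dim (C0 X') < dim (C0 X))%N &
     (dim (C1 X') < dim (C1 X))%N].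
Proof.
move=> pi0 pi1.
have iE0 (a : A^o) : f0 i a = a *: f0 i 1 by rewrite -linearZ /GRing.scale /= mulr1.
have iE1 (a : A^o) : f1 i a = a *: f1 i 1 by rewrite -linearZ /GRing.scale /= mulr1.
have [n0 [i0 [r0 [dm0 ri0 pi00 rv0 ir0]]]] := surjection_kernel_free (pi0 1).
have [n1 [i1 [r1 [dm1 ri1 pi11 rv1 ir1]]]] := surjection_kernel_free (pi1 1).
pose D0 : {linear 'rV[A]_n0 -> 'rV[A]_n1} := r1 \o (d0 X \o i0).
pose D1 : {linear 'rV[A]_n1 -> 'rV[A]_n0} := r0 \o (d1 X \o i1).
have iD0 t : i1 (D0 t) = d0 X (i0 t).
  by rewrite ir1 f1d0 pi00 linear0 scale0r subr0.
have iD1 t : i0 (D1 t) = d1 X (i1 t).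
  by rewrite ir0 f0d1 pi11 linear0 scale0r subr0.
have DD0 t : D1 (D0 t) = 0 by rewrite /= -[i1 _]/(i1 (D0 t)) iD0 d1d0 linear0.
have DD1 t : D0 (D1 t) = 0 by rewrite /= -[i0 _]/(i0 (D1 t)) iD1 d0d1 linear0.
pose X' := @Complex2 A 'rV[A]_n0 'rV[A]_n1 D0 D1 DD0 DD1.
have rd0 : r1 (d0 X (f0 i 1)) = 0.
  by rewrite -f1d0 iE1 linearZ /= rv1 scaler0.
have rd1 : r0 (d1 X (f1 i 1)) = 0.
  by rewrite -f0d1 iE0 linearZ /= rv0 scaler0.
have rc0 t : r1 (d0 X t) = D0 (r0 t).
  rewrite /= ir0 (linearB (d0 X)) (linearB r1) (linearZ_LR (d0 X)) (linearZ_LR r1).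
  by rewrite rd0 scaler0 subr0.
have rc1 t : r0 (d1 X t) = D1 (r1 t).
  rewrite /= ir1 (linearB (d1 X)) (linearB r0) (linearZ_LR (d1 X)) (linearZ_LR r0).
  by rewrite rd1 scaler0 subr0.
pose r : cmap X X' := @CMap A X X' r0 r1 rc0 rc1.
pose j : cmap X' X := @CMap A X' X i0 i1 iD0 iD1.
exists X'; split; last 2 first.
- by rewrite dm0 /= /dim /= mul1n.
- by rewrite dm1 /= /dim /= mul1n.
exists (dpair p r), (dcopair i j); split; apply: eq_homotopic => t.
- suff : f0 i (f0 p t + 0) + i0 (0 + r0 t) = t by [].
  by rewrite addr0 add0r ir0 iE0 addrC subrK.
- suff : f1 i (f1 p t + 0) + i1 (0 + r1 t) = t by [].
  by rewrite addr0 add0r ir1 iE1 addrC subrK.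
- case: t => a t.
  suff : (f0 p (f0 i a + i0 t) + 0, 0 + r0 (f0 i a + i0 t)) = (a, t) by [].
  by rewrite addr0 add0r !linearD pi0 pi00 ri0 iE0 linearZ /= rv0 scaler0 addr0 add0r.
- case: t => a t.
  suff : (f1 p (f1 i a + i1 t) + 0, 0 + r1 (f1 i a + i1 t)) = (a, t) by [].
  by rewrite addr0 add0r !linearD pi1 pi11 ri1 iE1 linearZ /= rv1 scaler0 addr0 add0r.
Qed.

(** The inclusion sends the generators of K(j) to w and e, and the retraction is (q, p).
    Compatibility with [d0] is checked after multiplication by x^j, where it follows from d0 d1 = 0
    and d1 d0 = 0, as free modules have no torsion. *)
Lemma split_Kosz (X : complex2 A) : (exists t, d1 X t != 0) ->
  exists j X', [/\ isomorphic X (dsum (Kosz x j) X'), (dim (C0 X') < dim (C0 X))%N &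
     (dim (C1 X') < dim (C1 X))%N].
Proof.
move=> /pivot[j [e [w [p [q [de pe qw qd]]]]]]; exists j.
have xj0 := expx_neq0 j.
have il0 : linear (fun a : A^o => a *: w).
  by move=> a s t; rewrite scalerDl scalerA.
have il1 : linear (fun a : A^o => a *: e).
  by move=> a s t; rewrite scalerDl scalerA.
have ic0 t : mklin il1 (d0 (Kosz x j) t) = d0 X (mklin il0 t).
  rewrite /= /mklin_fun scale0r linearZ /=.
  suff -> : d0 X w = 0 by rewrite scaler0.
  by apply: (vect_scale_eq0 xj0); rewrite -linearZ /= -de d0d1.
have ic1 t : mklin il0 (d1 (Kosz x j) t) = d1 X (mklin il1 t).
  by rewrite /= /mklin_fun linearZ /= de scalerA mulrC.
have pc0 t : p (d0 X t) = d0 (Kosz x j) (q t).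
  by apply: (mulfI xj0); rewrite -qd d1d0 linear0 mulr0.
have := @split_off X _ _ _ _ (@CMap A (Kosz x j) X _ _ ic0 ic1)
  (@CMap A X (Kosz x j) q p pc0 qd); apply=> t /=; rewrite /mklin_fun linearZ /=.
  by rewrite qw /GRing.scale /= mulr1.
by rewrite pe /GRing.scale /= mulr1.
Qed.

Lemma Kosz0_zero : is_zero (Kosz x 0).
Proof.
exists idfun, \0; split=> t; rewrite /= /Kosz_d1 ?mul1r subr0 ?addr0 //.
by rewrite add0r.
Qed.

Lemma Kvertex0_zero e : is_zero (Kvertex x e 0).
Proof. by case: e; [apply/is_zero_shift|]; exact: Kosz0_zero. Qed.

Definition vertex_sum (s : seq (bool * nat)) : complex2 A :=
  big_dsum [seq Kvertex x v.1 v.2 | v <- s].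

Lemma split_Kvertex (X : complex2 A) : in_Kf X -> ~ is_zero X ->
  exists e j X', isomorphic X (dsum (Kvertex x e j) X') /\
    (dim (C0 X') + dim (C1 X') < dim (C0 X) + dim (C1 X))%N.
Proof.
move=> [X0 X1] nzX.
have [d1nz|d1z] := pselect (exists t, d1 X t != 0).
  have [j [X' [XX' lt0 lt1]]] := split_Kosz d1nz.
  by exists false, j, X'; split; last by rewrite -addSn leq_add // ltnW.
have [d0nz|d0z] := pselect (exists t, d0 X t != 0).
  have [|j [X' [XX' lt0 lt1]]] := @split_Kosz (shift X).
    by have [t dt] := d0nz; exists t; rewrite /= oppr_eq0.
  exists true, j, (shift X'); split; last by rewrite -addSn leq_add // ltnW.
  apply: isomorphic_trans (isomorphic_shift2 X) _.
  apply: isomorphic_trans (proj2 (isomorphic_shift _ _) XX') _.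
  by exists (shift_dsum _ _); exact: shift_dsum_iso.
have d0E t : d0 X t = 0.
  by apply/eqP; apply: contrapT => /negP dt; apply: d0z; exists t.
have d1E t : d1 X t = 0.
  by apply/eqP; apply: contrapT => /negP dt; apply: d1z; exists t.
case: nzX; apply: eq_homotopic => t /=.
  exact: (finite_length_zero_maps d1E d0E X0).
exact: (finite_length_zero_maps d0E d1E X1).
Qed.

Lemma decomposition (X : complex2 A) : in_Kf X ->
  exists s, all (fun v => 0 < v.2)%N s /\ isomorphic X (vertex_sum s).
Proof.
have [m] := ubnP (dim (C0 X) + dim (C1 X)); elim: m X => // m IH X Xm KX.
have [X0|nzX] := pselect (is_zero X).
  exists [::]; split=> //; exists (czero _ _); apply: split_iso.
    by exists (czero _ _); rewrite (X0 : cid X ~h _) ccomp0f.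
  by exists (czero _ _); rewrite (@zero_complex_is_zero A : cid _ ~h _) ccomp0f.
have [e [j [X' [XX' ltX]]]] := split_Kvertex KX nzX.
have KX' : in_Kf X'.
  apply: in_Kf_retract (_ : in_Kf (dsum (Kvertex x e j) X')).
    by exists (dsnd _ _); exact: dsnd_inr.
  exact: in_Kf_isomorphic (isomorphic_sym XX') KX.
have [|s [sp Xs]] := IH X' _ KX'; first exact: leq_trans ltX Xm.
(* A pivot that is a unit gives j = 0; this summand is contractible and is left out of the list. *)
case: j XX' => [|j] XX'; last first.
  exists ((e, j.+1) :: s); split=> //.
  exact: isomorphic_trans XX' (isomorphic_dsum (isomorphic_refl _) Xs).
exists s; split=> //; apply: isomorphic_trans XX' _.
apply: isomorphic_trans Xs; exists (dsnd _ _).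
exact: dsum_zero_l_iso (Kvertex0_zero e).
Qed.

End Valuation.

(** * Morphisms between the vertices *)

Section Vertices.
Variables (A : idomainType) (x : A) (k : closedFieldType) (rho : {rmorphism A -> k}).
Hypotheses (hDVR : is_DVR x) (hcomplete : adically_complete x).
Hypothesis hres : is_residue_map x rho.

Notation K i := (Kosz x i).

Lemma rho_unit a : rho a != 0 -> a \is a GRing.unit.
Proof.
move=> ra; have [//|am] := unit_or_multiple hDVR a.
by case/eqP: ra; apply/(hres.2 a).
Qed.

Lemma rho_multiple c : rho (c * x) = 0.
Proof. by apply/(hres.2 _); exists c. Qed.

Lemma rho_multiple_exp c n : (0 < n)%N -> rho (c * x ^+ n) = 0.
Proof. by case: n => // n _; rewrite exprSr mulrA rho_multiple. Qed.

Lemma expx_inj_r n (a b : A) : a * x ^+ n = b * x ^+ n -> a = b.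
Proof. exact: mulIf (expx_neq0 hDVR n) a b. Qed.

Fact mulr_regular_linear (a : A) : linear (fun t : A^o => t * a : A^o).
Proof. by move=> c u v; rewrite mulrDl -scalerAl. Qed.
Definition lmul a := mklin (mulr_regular_linear a).

Lemma regular_linear (f : {linear A^o -> A^o}) t : f t = t * f 1.
Proof. by have := linearZ_LR f t 1; rewrite /GRing.scale /= mulr1. Qed.

Fact kk_comm0 i j a b : a * x ^+ i = x ^+ j * b -> forall t,
  lmul b (d0 (K i) t) = d0 (K j) (lmul a t).
Proof. by move=> _ t; rewrite /= /mklin_fun mul0r. Qed.
Fact kk_comm1 i j a b : a * x ^+ i = x ^+ j * b -> forall t,
  lmul a (d1 (K i) t) = d1 (K j) (lmul b t).
Proof.
move=> e t; rewrite /= /mklin_fun /Kosz_d1 mulrAC [x ^+ i * a]mulrC e -mulrA.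
by rewrite [b * t]mulrC.
Qed.
Definition kk i j a b (e : a * x ^+ i = x ^+ j * b) : cmap (K i) (K j) :=
  @CMap A (K i) (K j) _ _ (kk_comm0 e) (kk_comm1 e).

Fact ks_comm0 i j b t : lmul b (d0 (K i) t) = d0 (shift (K j)) (lmul 0 t).
Proof. by rewrite /= /mklin_fun /Kosz_d1 mul0r !mulr0 oppr0. Qed.
Fact ks_comm1 i j b t : lmul 0 (d1 (K i) t) = d1 (shift (K j)) (lmul b t).
Proof. by rewrite /= /mklin_fun mulr0 oppr0. Qed.
(** As x^j is a nonzerodivisor, every chain map K(i) -> K(j)[1] vanishes in even degrees
    ([ks_coef]), so the odd scalar b is all the data. Dually, [sk] keeps only an even scalar. *)
Definition ks i j b : cmap (K i) (shift (K j)) :=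
  @CMap A (K i) (shift (K j)) _ _ (@ks_comm0 i j b) (@ks_comm1 i j b).

Fact sk_comm0 i j a t : lmul 0 (d0 (shift (K i)) t) = d0 (K j) (lmul a t).
Proof. by rewrite /= /mklin_fun mulr0. Qed.
Fact sk_comm1 i j a t : lmul a (d1 (shift (K i)) t) = d1 (K j) (lmul 0 t).
Proof. by rewrite /= /mklin_fun /Kosz_d1 oppr0 mul0r !mulr0. Qed.
Definition sk i j a : cmap (shift (K i)) (K j) :=
  @CMap A (shift (K i)) (K j) _ _ (@sk_comm0 i j a) (@sk_comm1 i j a).

Lemma kk_coef i j (f : cmap (K i) (K j)) : f0 f 1 * x ^+ i = x ^+ j * f1 f 1.
Proof.
have := f0d1 f 1; rewrite /= /Kosz_d1 mulr1 => <-.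
by rewrite [RHS](regular_linear (f0 f)) mulrC.
Qed.

Lemma ks_coef i j (f : cmap (K i) (shift (K j))) : f0 f 1 = 0.
Proof.
have /esym/eqP := f1d0 f 1; rewrite /= linear0 /Kosz_d1 oppr_eq0 mulf_eq0.
by rewrite (negbTE (expx_neq0 hDVR j)) => /eqP.
Qed.

Lemma sk_coef i j (f : cmap (shift (K i)) (K j)) : f1 f 1 = 0.
Proof.
have /esym/eqP := f0d1 f 1; rewrite /= oppr0 linear0 /Kosz_d1 mulf_eq0.
by rewrite (negbTE (expx_neq0 hDVR j)) => /eqP.
Qed.

(** A homotopy changes the even scalar by a multiple of x^j, and the relation a x^i = x^j b then
    determines the change of the odd one. *)
Lemma kk_null0 i j (f : cmap (K i) (K j)) :
  f ~h czero _ _ <-> exists c, f0 f 1 = c * x ^+ j.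
Proof.
split=> [[s0 [s1 [h0 _]]]|[c fc]].
  exists (s0 1); have := h0 1; rewrite /= subr0 linear0 addr0 /Kosz_d1 => ->.
  exact: mulrC.
have fc1 : f1 f 1 = x ^+ i * c.
  apply: (mulfI (expx_neq0 hDVR j)); rewrite -kk_coef fc; ring.
exists (lmul c), \0; split=> t; rewrite /= /mklin_fun subr0 /Kosz_d1.
  by rewrite (regular_linear (f0 f)) fc addr0 mulrA mulrC.
by rewrite (regular_linear (f1 f)) fc1 add0r mulrCA mulrA.
Qed.

(** The criterion for i < j, where only the odd scalar can be a unit; [irreducible_up] reads the
    residue of that scalar. *)
Lemma kk_null1 i j (f : cmap (K i) (K j)) :
  f ~h czero _ _ <-> exists c, f1 f 1 = c * x ^+ i.
Proof.
rewrite kk_null0; split=> -[c fc]; exists c.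
  apply: (mulfI (expx_neq0 hDVR j)); rewrite -kk_coef fc.
  by rewrite mulrA (mulrC c).
by apply: (@expx_inj_r i); rewrite kk_coef fc mulrA (mulrC c).
Qed.

(** The two halves of a homotopy contribute multiples of x^i and of x^j, so Hom(K(i), K(j)[1]) is A
    modulo x^min(i, j). *)
Lemma ks_null i j (f : cmap (K i) (shift (K j))) :
  f ~h czero _ _ <-> exists c c', f1 f 1 = c * x ^+ i + c' * x ^+ j.
Proof.
split=> [[s0 [s1 [_ h1]]]|[c [c' fc]]].
  exists (s0 1), (- s1 1); have := h1 1.
  rewrite /= subr0 /Kosz_d1 mulr1 (regular_linear s0) => ->.
  by rewrite addrC mulNr mulrC; congr (_ - _); exact: mulrC.
exists (lmul c), (lmul (- c')); split=> t; rewrite /= /mklin_fun subr0 /Kosz_d1.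
  by rewrite (regular_linear (f0 f)) ks_coef mulr0 oppr0 mul0r addr0.
rewrite (regular_linear (f1 f)) fc; ring.
Qed.

Lemma sk_null i j (f : cmap (shift (K i)) (K j)) :
  f ~h czero _ _ <-> exists c c', f0 f 1 = c * x ^+ i + c' * x ^+ j.
Proof.
split=> [[s0 [s1 [h0 _]]]|[c [c' fc]]].
  exists (- s1 1), (s0 1); have := h0 1.
  rewrite /= subr0 /Kosz_d1 mulr1 linearN (regular_linear s1) => ->.
  by ring.
exists (lmul c'), (lmul (- c)); split=> t; rewrite /= /mklin_fun subr0 /Kosz_d1.
  rewrite (regular_linear (f0 f)) fc; ring.
by rewrite (regular_linear (f1 f)) sk_coef mulr0 oppr0 mul0r addr0.
Qed.

Lemma kk_iso i (f : cmap (K i) (K i)) : f0 f 1 \is a GRing.unit -> is_iso f.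
Proof.
move=> au; have ab : f1 f 1 = f0 f 1.
  by apply: (@expx_inj_r i); rewrite kk_coef mulrC.
have e : (f0 f 1)^-1 * x ^+ i = x ^+ i * (f0 f 1)^-1 by exact: mulrC.
exists (kk e); split; apply: eq_homotopic => t; rewrite /= /mklin_fun.
- by rewrite (regular_linear (f0 f)) mulrK.
- by rewrite (regular_linear (f1 f)) ab mulrK.
- by rewrite (regular_linear (f0 f)) mulrVK.
- by rewrite (regular_linear (f1 f)) ab mulrVK.
Qed.

(* The residue of an endomorphism of an indecomposable object in its residue
   field: End(K(i)) is A/(x^i), with residue field k. *)
Definition resid e i : cmap (Kvertex x e i) (Kvertex x e i) -> k :=
  match e with
  | true => fun f => rho (f0 (unshift f) 1)
  | false => fun f => rho (f0 f 1)
  end.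
Arguments resid : clear implicits.

Lemma resid_homotopic e i f g : (0 < i)%N -> f ~h g -> resid e i f = resid e i g.
Proof.
have H (u v : cmap (K i) (K i)) : (0 < i)%N -> u ~h v -> rho (f0 u 1) = rho (f0 v 1).
  move=> i0 /csub_homotopic0/kk_null0[c /= fc]; apply/eqP.
  by rewrite -subr_eq0 -rmorphB fc rho_multiple_exp.
case: e f g => f g i0 fg; last exact: H.
by apply: H i0 _; exact: unshift_homotopic.
Qed.

Lemma resid_add e i f g : resid e i (cadd f g) = resid e i f + resid e i g.
Proof. by case: e f g => f g; rewrite /= rmorphD. Qed.

Lemma resid_comp e i f g : resid e i (ccomp g f) = resid e i g * resid e i f.
Proof.
case: e f g => f g /=.
  by rewrite (regular_linear (f1 g)) rmorphM mulrC.
by rewrite (regular_linear (f0 g)) rmorphM mulrC.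
Qed.

Lemma resid_id e i : resid e i (cid _) = 1.
Proof. by case: e; rewrite /= rmorph1. Qed.

Lemma resid0 e i : resid e i (czero _ _) = 0.
Proof. by case: e; rewrite /= rmorph0. Qed.

Lemma resid_iso e i f : resid e i f != 0 -> is_iso f.
Proof.
case: e f => f /= /rho_unit fu; last exact: kk_iso.
apply: homotopic_iso (unshiftK f) _; apply/shift_map_iso; exact: kk_iso.
Qed.

(** A nonzero residue makes the even scalars of both factors units, and a unit in a x^i = x^j b
    gives j <= i; the two factors yield both inequalities. For vertices of opposite parity one of
    the scalars involved is zero. *)
Lemma resid_through e i e' j (u : cmap (Kvertex x e i) (Kvertex x e' j))
    (v : cmap (Kvertex x e' j) (Kvertex x e i)) :
  resid e i (ccomp v u) != 0 -> e = e' /\ i = j.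
Proof.
have KK (f : cmap (K i) (K j)) (g : cmap (K j) (K i)) :
    rho (f0 g (f0 f 1)) != 0 -> i = j.
  rewrite (regular_linear (f0 g)) rmorphM mulf_eq0 negb_or.
  case/andP=> /rho_unit fu /rho_unit gu.
  have := kk_coef g; rewrite [RHS]mulrC => /(valuation_le hDVR gu) ij.
  have := kk_coef f; rewrite [RHS]mulrC => /(valuation_le hDVR fu) ji.
  by apply/eqP; rewrite eqn_leq ij ji.
case: e e' u v => -[] u v /= H.
- by split=> //; exact: (KK (unshift u) (unshift v)).
- by rewrite sk_coef linear0 rmorph0 eqxx in H.
- by rewrite ks_coef linear0 rmorph0 eqxx in H.
- by split=> //; exact: KK H.
Qed.

Lemma Kvertex_retract e i e' j (u : cmap (Kvertex x e i) (Kvertex x e' j))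
    (v : cmap (Kvertex x e' j) (Kvertex x e i)) :
  (0 < i)%N -> ccomp v u ~h cid _ -> e = e' /\ i = j.
Proof.
move=> i0 vu; apply: (resid_through (u := u) (v := v)).
by rewrite (resid_homotopic i0 vu) resid_id oner_eq0.
Qed.

Lemma Kvertex_inj e i e' j : (0 < i)%N ->
  isomorphic (Kvertex x e i) (Kvertex x e' j) -> e = e' /\ i = j.
Proof. by move=> i0 [f [g [gf _]]]; exact: Kvertex_retract i0 gf. Qed.

Lemma Kvertex_nonzero e i : (0 < i)%N -> ~ is_zero (Kvertex x e i).
Proof.
move=> i0 /(resid_homotopic i0); rewrite resid_id resid0 => /eqP.
by rewrite oner_eq0.
Qed.

Lemma idempotent_iso (X : complex2 A) (e : cmap X X) :
  is_iso e -> ccomp e e ~h e -> e ~h cid X.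
Proof.
by case=> g [ge eg] ee; rewrite -(ccomp1f e) -ge -ccompA ee.
Qed.

Lemma retract_idempotent (X Y : complex2 A) (i : cmap Y X) (p : cmap X Y) :
  ccomp p i ~h cid Y -> ccomp (ccomp i p) (ccomp i p) ~h ccomp i p /\
    (ccomp i p ~h czero X X -> is_zero Y).
Proof.
move=> pi; split=> [|ip0].
  by rewrite -ccompA (ccompA p) pi ccomp1f.
rewrite /is_zero -{1}pi -(ccompf1 i) -pi (ccompA i) ip0.
by rewrite ccomp0f ccompf0.
Qed.

(** A decomposition gives idempotents a and b with a + b the identity. Their residues add up to 1,
    so one of them is invertible, hence equal to the identity, and the other is zero. *)
Lemma Kvertex_indecomposable e i : (0 < i)%N -> indecomposable (Kvertex x e i).
Proof.
move=> i0; split; [exact: in_Kf_Kvertex | exact: Kvertex_nonzero |].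
move=> Y Z _ _ [f [g [gf fg]]].
have [|aa aY] := @retract_idempotent _ _ (ccomp g (dinl Y Z)) (ccomp (dfst Y Z) f).
  by rewrite -ccompA (ccompA f) fg ccomp1f dfst_inl.
have [|bb bZ] := @retract_idempotent _ _ (ccomp g (dinr Y Z)) (ccomp (dsnd Y Z) f).
  by rewrite -ccompA (ccompA f) fg ccomp1f dsnd_inr.
pose a := ccomp (ccomp g (dinl Y Z)) (ccomp (dfst Y Z) f).
pose b := ccomp (ccomp g (dinr Y Z)) (ccomp (dsnd Y Z) f).
rewrite -/a in aa aY; rewrite -/b in bb bZ.
have ab : cadd a b ~h cid _.
  exact: homotopic_trans (homotopic_sym (dsum_comp g f)) gf.
have ba : cadd b a ~h cid _.
  by rewrite -ab; apply: eq_homotopic => t; rewrite /= addrC.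
have H (u v : cmap (Kvertex x e i) (Kvertex x e i)) : ccomp u u ~h u ->
    cadd u v ~h cid _ -> resid e i u != 0 -> v ~h czero _ _.
  move=> uu uv /resid_iso/idempotent_iso/(_ uu) u1.
  have -> : v ~h cadd (copp u) (cadd u v).
    by apply: eq_homotopic => t /=; rewrite addKr.
  by rewrite uv u1; apply: eq_homotopic => t /=; rewrite addNr.
have [a0|/(H _ _ aa ab)/bZ] := eqVneq (resid e i a) 0; last by right.
left; apply: aY; apply: H bb ba _.
have := resid_homotopic i0 ab; rewrite resid_add a0 add0r resid_id => ->.
exact: oner_neq0.
Qed.

Lemma indecomposable_isomorphic (X Y : complex2 A) :
  isomorphic X Y -> indecomposable Y -> indecomposable X.
Proof.
move=> XY [KY nY dY]; split.
- exact: in_Kf_isomorphic KY.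
- by move=> /(is_zero_isomorphic XY).
- move=> U V KU KV XUV; apply: dY => //.
  exact: isomorphic_trans (isomorphic_sym XY) XUV.
Qed.

Lemma indecomposableP (X : complex2 A) : indecomposable X <->
  exists e i, (0 < i)%N /\ isomorphic X (Kvertex x e i).
Proof.
split=> [[KX nX dX]|[e [i [i0 Xi]]]]; last first.
  exact: indecomposable_isomorphic Xi (Kvertex_indecomposable e i0).
have [[|[e i] s] [/= sp Xs]] := decomposition hDVR hcomplete KX.
  by case: nX; apply/(is_zero_isomorphic Xs); exact: zero_complex_is_zero.
case/andP: sp => i0 sp; exists e, i; split=> //.
have Ks : in_Kf (vertex_sum x s).
  apply: in_Kf_retract (in_Kf_isomorphic (isomorphic_sym Xs) KX).
  by exists (dsnd _ _); exact: dsnd_inr.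
have [|E0|s0] := dX _ _ _ Ks Xs; first exact: in_Kf_Kvertex.
  by case: (Kvertex_nonzero (e := e) i0).
apply: isomorphic_trans Xs _; exists (dfst _ _); exact: dsum_zero_r_iso.
Qed.

End Vertices.

(** * AR-triangles *)

Section StandardTriangle.
Variables (A : idomainType) (x : A) (n : nat).

Notation K i := (Kosz x i).

Fact std_map_eq1 : 1 * x ^+ n.+1 = x ^+ n * x.
Proof. by rewrite mul1r exprSr. Qed.
Fact std_map_eq2 : x * x ^+ n.+1 = x ^+ n.+2 * 1.
Proof. by rewrite mulr1 -exprS. Qed.
(** In even degrees t goes to (t, xt), in odd degrees to (xt, t). For n = 0 the summand K(0) is
    contractible. *)
Definition std_map : cmap (K n.+1) (dsum (K n) (K n.+2)) :=
  dpair (kk std_map_eq1) (kk std_map_eq2).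

(** Since [std_map] is split injective in each degree, its cone is equivalent to its cokernel. With
    coordinates (u, (y, z)), the cokernel is read off by z - xy in even and by xz - y in odd
    degrees. *)
Definition std_out0_fun (t : A^o * (A^o * A^o)) : A^o := t.2.2 - t.2.1 * x.
Definition std_out1_fun (t : A^o * (A^o * A^o)) : A^o := t.2.2 * x - t.2.1.
Fact std_out0_linear : linear std_out0_fun.
Proof. by move=> a u v; rewrite /std_out0_fun /= /GRing.scale /=; ring. Qed.
Fact std_out1_linear : linear std_out1_fun.
Proof. by move=> a u v; rewrite /std_out1_fun /= /GRing.scale /=; ring. Qed.
Definition std_out0 : {linear C0 (cone std_map) -> C0 (K n.+1)} :=
  mklin std_out0_linear.
Definition std_out1 : {linear C1 (cone std_map) -> C1 (K n.+1)} :=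
  mklin std_out1_linear.
Fact std_out_comm0 t : std_out1 (d0 (cone std_map) t) = d0 (K n.+1) (std_out0 t).
Proof.
by rewrite /= /mklin_fun /std_out1_fun /= /mklin_fun /=; ring.
Qed.
Fact std_out_comm1 t : std_out0 (d1 (cone std_map) t) = d1 (K n.+1) (std_out1 t).
Proof.
rewrite /= /mklin_fun /std_out0_fun /std_out1_fun /= /mklin_fun /= /Kosz_d1.
by rewrite !exprS; ring.
Qed.
Definition std_out : cmap (cone std_map) (K n.+1) :=
  @CMap A (cone std_map) (K n.+1) _ _ std_out_comm0 std_out_comm1.

(** A section of [std_out]: z = t in even and y = -t in odd degrees. Compatibility with the
    differential forces the first coordinate -x^n t in odd degrees, and this is where the connecting
    map x^n comes from. *)
Definition std_in0_fun (t : A^o) : A^o * (A^o * A^o) := (0, (0, t)).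
Definition std_in1_fun (t : A^o) : A^o * (A^o * A^o) := (- (t * x ^+ n), (- t, 0)).
Fact std_in0_linear : linear std_in0_fun.
Proof. by move=> a u v; congr (_, (_, _)); rewrite /= scaler0 addr0. Qed.
Fact std_in1_linear : linear std_in1_fun.
Proof. by move=> a u v; congr (_, (_, _)); rewrite /= /GRing.scale /=; ring. Qed.
Definition std_in0 : {linear C0 (K n.+1) -> C0 (cone std_map)} :=
  mklin std_in0_linear.
Definition std_in1 : {linear C1 (K n.+1) -> C1 (cone std_map)} :=
  mklin std_in1_linear.
Fact std_in_comm0 t : std_in1 (d0 (K n.+1) t) = d0 (cone std_map) (std_in0 t).
Proof.
congr (_, (_, _)); rewrite /= /mklin_fun /= /Kosz_d1; ring.
Qed.
Fact std_in_comm1 t : std_in0 (d1 (K n.+1) t) = d1 (cone std_map) (std_in1 t).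
Proof.
congr (_, (_, _)); rewrite /= /mklin_fun /= /Kosz_d1 ?exprS; ring.
Qed.
Definition std_in : cmap (K n.+1) (cone std_map) :=
  @CMap A (K n.+1) (cone std_map) _ _ std_in_comm0 std_in_comm1.

Lemma std_out_in : ccomp std_out std_in ~h cid (K n.+1).
Proof.
by apply: eq_homotopic => t;
  rewrite /= /mklin_fun /std_out0_fun /std_out1_fun /=; ring.
Qed.

Lemma std_in_out : ccomp std_in std_out ~h cid (cone std_map).
Proof.
apply: homotopic_sym.
(* Up to sign, the degreewise retractions of [std_map]: y in even and z in odd degrees. *)
pose s0 (t : A^o * (A^o * A^o)) : A^o * (A^o * A^o) := (- t.2.1, (0, 0)).
pose s1 (t : A^o * (A^o * A^o)) : A^o * (A^o * A^o) := (- t.2.2, (0, 0)).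
have l0 : linear s0.
  by move=> a u v; congr (_, (_, _)); rewrite /= /GRing.scale /=; ring.
have l1 : linear s1.
  by move=> a u v; congr (_, (_, _)); rewrite /= /GRing.scale /=; ring.
exists (mklin l0 : {linear C0 (cone std_map) -> C1 (cone std_map)}),
  (mklin l1 : {linear C1 (cone std_map) -> C0 (cone std_map)}).
split=> -[u [y z]]; congr (_, (_, _)).
all: rewrite /= /mklin_fun /= /std_out0_fun /std_out1_fun /= /mklin_fun /=.
all: rewrite /Kosz_d1 ?exprS; ring.
Qed.

Lemma std_out_iso : is_iso std_out.
Proof. by exists std_in; split; [exact: std_in_out | exact: std_out_in]. Qed.

Definition std_triangle : triangle A :=
  @Triangle A (K n.+1) (dsum (K n) (K n.+2)) (K n.+1) std_map
    (ccomp std_out (cone_in std_map)) (ks x n.+1 n.+1 (x ^+ n)).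

Lemma std_triangle_connecting :
  ccomp (ks x n.+1 n.+1 (x ^+ n)) std_out ~h cone_out std_map.
Proof.
have -> : ks x n.+1 n.+1 (x ^+ n) ~h ccomp (cone_out std_map) std_in.
  apply: eq_homotopic => t /=; rewrite /mklin_fun /cone_out0 /cone_out1 /=.
    by rewrite mulr0 oppr0.
  by rewrite opprK.
by rewrite -ccompA std_in_out ccompf1.
Qed.

Lemma std_triangle_exact : is_DVR x -> adically_complete x ->
  exact_triangle std_triangle.
Proof.
move=> hDVR hc; exists (K n.+1), (dsum (K n) (K n.+2)), std_map; split.
- exact: in_Kf_Kosz.
- by apply: in_Kf_dsum; exact: in_Kf_Kosz.
- exists (cid _), (cid _), std_out; split.
    by split; [exact: id_iso | exact: id_iso | exact: std_out_iso].
  split; first by rewrite ccompf1 ccomp1f.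
    by rewrite ccompf1.
  by rewrite std_triangle_connecting shift_map_id ccomp1f.
Qed.

End StandardTriangle.

(** * The shift of a triangle *)

Section ShiftTriangle.
Variable A : idomainType.
Implicit Types (X Y : complex2 A) (S T : triangle A).

(** The sign on the connecting map is the one for which the shift of a cone triangle is again exact,
    by [shift_cone_iso]. *)
Definition shift_triangle T : triangle A :=
  Triangle (shift_map (ta T)) (shift_map (tb T)) (copp (shift_map (th T))).

Lemma shift_triangle_iso S T :
  triangle_iso S T -> triangle_iso (shift_triangle S) (shift_triangle T).
Proof.
move=> [p [q [r [[pi qi ri] [h1 h2 h3]]]]].
exists (shift_map p), (shift_map q), (shift_map r); split.
  by split; apply/shift_map_iso.
split=> /=; rewrite ?ccompNl ?ccompNr -!shift_map_comp.
- by rewrite h1.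
- by rewrite h2.
- by rewrite h3.
Qed.

Lemma shift_triangle2 T : triangle_iso T (shift_triangle (shift_triangle T)).
Proof.
exists (shift2 _), (shift2 _), (shift2 _); split.
  by split; exact: shift2_iso.
by split; apply: eq_homotopic => t //=; rewrite ?opprK.
Qed.

Lemma shift_cone_iso X Y (f : cmap X Y) :
  triangle_iso (cone_triangle (shift_map f)) (shift_triangle (cone_triangle f)).
Proof.
apply: triangle_iso_sym.
(* The shifted cone of f and the cone of the shifted f have the same components; negating the
   coordinate from X reconciles their differentials. *)
pose r0 (t : C0 X * C1 Y) : C0 X * C1 Y := (- t.1, t.2).
pose r1 (t : C1 X * C0 Y) : C1 X * C0 Y := (- t.1, t.2).
have l0 : linear r0.
  by move=> a u v; congr (_, _); rewrite /= opprD scalerN.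
have l1 : linear r1.
  by move=> a u v; congr (_, _); rewrite /= opprD scalerN.
pose S := shift (cone f); pose T := cone (shift_map f).
pose R0 : {linear C0 S -> C0 T} := mklin l0.
pose R1 : {linear C1 S -> C1 T} := mklin l1.
pose R0' : {linear C0 T -> C0 S} := mklin l0.
pose R1' : {linear C1 T -> C1 S} := mklin l1.
have c0 t : R1 (d0 S t) = d0 T (R0 t).
  apply: injective_projections; rewrite /= /mklin_fun /=.
    by rewrite (linearN (d0 X)).
  by rewrite (linearN (f0 f)) opprB opprK addrC.
have c1 t : R0 (d1 S t) = d1 T (R1 t).
  apply: injective_projections; rewrite /= /mklin_fun /=.
    by rewrite (linearN (d1 X)).
  by rewrite (linearN (f1 f)) opprB opprK addrC.
have c0' t : R1' (d0 T t) = d0 S (R0' t).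
  apply: injective_projections; rewrite /= /mklin_fun /=.
    by rewrite (linearN (d0 X)).
  by rewrite (linearN (f0 f)) opprK opprD.
have c1' t : R0' (d1 T t) = d1 S (R1' t).
  apply: injective_projections; rewrite /= /mklin_fun /=.
    by rewrite (linearN (d1 X)).
  by rewrite (linearN (f1 f)) opprK opprD.
exists (cid _), (cid _), (CMap c0 c1); split.
  split; [exact: id_iso | exact: id_iso | exists (CMap c0' c1')].
  by split; apply: eq_homotopic => -[u v]; rewrite /= /mklin_fun /r0 /r1 /= opprK.
split; apply: eq_homotopic => t //=.
- by rewrite /mklin_fun /r0 /= oppr0.
- by rewrite /mklin_fun /r1 /= oppr0.
Qed.

Lemma shift_triangle_exact T : exact_triangle T -> exact_triangle (shift_triangle T).
Proof.
move=> [X [Y [f [KX KY fT]]]]; exists (shift X), (shift Y), (shift_map f).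
split; [exact/in_Kf_shift | exact/in_Kf_shift |].
exact: triangle_iso_trans (shift_cone_iso f) (shift_triangle_iso fT).
Qed.

Lemma indecomposable_shift X : indecomposable X -> indecomposable (shift X).
Proof.
move=> [KX nX dX]; split; first exact/in_Kf_shift.
  by move/is_zero_shift.
move=> Y Z; have [Y' <-] := shift_surj Y; have [Z' <-] := shift_surj Z.
move=> /in_Kf_shift KY /in_Kf_shift KZ XYZ.
have [|Y0|Z0] := dX Y' Z' KY KZ; last 2 first.
- by left; apply/is_zero_shift.
- by right; apply/is_zero_shift.
apply/isomorphic_shift; apply: isomorphic_trans XYZ _; apply: isomorphic_sym.
by exists (shift_dsum _ _); exact: shift_dsum_iso.
Qed.

Lemma shift_triangle_AR T : AR_triangle T -> AR_triangle (shift_triangle T).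
Proof.
move=> [eT iM iN hT aT]; split.
- exact: shift_triangle_exact.
- exact: indecomposable_shift.
- exact: indecomposable_shift.
- move=> /= /copp_homotopic0 h0; apply: hT; apply: shift_map_inj.
  by rewrite h0 shift_map0.
- move=> D; have [D' <-] := shift_surj D => t iD nt.
  have H : ccomp (th T) (unshift t) ~h czero D' (shift (tN T)).
    apply: aT => [|it]; first by have := indecomposable_shift iD; rewrite shiftK.
    by apply: nt; apply: homotopic_iso (unshiftK t) _; apply/shift_map_iso.
  rewrite /= -(unshiftK t) ccompNl -shift_map_comp.
  by rewrite H shift_map0 copp0.
Qed.

End ShiftTriangle.

(** * Existence and uniqueness of AR-triangles *)

Section Classification.
Variables (A : idomainType) (x : A) (k : closedFieldType) (rho : {rmorphism A -> k}).
Hypotheses (hDVR : is_DVR x) (hcomplete : adically_complete x).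
Hypothesis hres : is_residue_map x rho.

Notation K i := (Kosz x i).

Lemma expx_split n m (b : A) : (n <= m)%N -> b * x ^+ m = b * x ^+ (m - n) * x ^+ n.
Proof. by move=> nm; rewrite -mulrA -exprD subnK. Qed.

(** The composite has scalar x^n times the odd scalar of t, to be read modulo x^min(l, n+1). For l
    <= n the factor x^n is already zero there; for l > n+1 the odd scalar is divisible by x; for l =
    n+1 it is so because t is not invertible; from K(l)[1] it vanishes. *)
Lemma std_connecting_kills n e l (t : cmap (Kvertex x e l) (K n.+1)) :
  ~ is_iso t -> ccomp (ks x n.+1 n.+1 (x ^+ n)) t ~h czero _ _.
Proof.
case: e t => t nt.
  apply: eq_homotopic => s; rewrite /= /mklin_fun ?mulr0 //.
  by rewrite (regular_linear (f1 t)) (sk_coef hDVR t) mulr0 mul0r.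
apply/(ks_null hDVR); rewrite /= /mklin_fun.
have tc := kk_coef t; case: (ltngtP l n.+1) => [ln|nl|ln].
- exists (f1 t 1 * x ^+ (n - l)), 0.
  by rewrite mul0r addr0; apply: expx_split.
- exists 0, (f0 t 1 * x ^+ (l - n.+2)); rewrite mul0r add0r.
  have -> : f1 t 1 = f0 t 1 * x ^+ (l - n.+1).
    apply: (mulfI (expx_neq0 hDVR n.+1)); rewrite -tc.
    by rewrite (expx_split _ (ltnW nl)) mulrC.
  rewrite -(subnSK nl) exprS (exprS x n). ring.
- subst l; have [tu|[c tcx]] := unit_or_multiple hDVR (f0 t 1).
    by case: nt; exact: kk_iso tu.
  exists c, 0; rewrite mul0r addr0 exprS mulrA -tcx; congr (_ * _).
  by apply: (mulfI (expx_neq0 hDVR n.+1)); rewrite -tc mulrC.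
Qed.

Lemma Kosz_noniso i j (t : cmap (K i) (K j)) : (0 < i)%N -> i != j -> ~ is_iso t.
Proof.
move=> i0 /eqP ij it; apply: ij.
have [|_ //] := @Kvertex_inj _ _ _ _ hDVR hres false i false j i0.
by exists t.
Qed.

Lemma shift_Kosz_noniso i j (t : cmap (shift (K i)) (K j)) : (0 < i)%N -> ~ is_iso t.
Proof.
move=> i0 it.
have [|//] := @Kvertex_inj _ _ _ _ hDVR hres true i false j i0.
by exists t.
Qed.

(** Let b be the scalar of h. If l <= n, testing on K(n) -> K(n+1) with odd scalar 1 puts b in
    (x^l), so h is null. If l > n, testing on K(n+2) -> K(n+1) with odd scalar x puts xb in
    (x^(n+2)) + (x^l). For l > n+1 this again makes h null; for l = n+1 it leaves b in (x^n). *)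
Lemma connecting_unique n l (h : cmap (K n.+1) (shift (K l))) : (0 < l)%N ->
  ~ (h ~h czero _ _) ->
  (forall j (t : cmap (K j) (K n.+1)), (0 < j)%N -> ~ is_iso t ->
    ccomp h t ~h czero _ _) ->
  exists p : cmap (K n.+1) (K l), is_iso p /\
    ccomp (shift_map p) (ks x n.+1 n.+1 (x ^+ n)) ~h h.
Proof.
move=> l0 hn hk.
have [ln|nl] := ltnP l n.+1.
  case: hn; apply/(ks_null hDVR).
  have e : x * x ^+ n = x ^+ n.+1 * 1 by rewrite exprS mulr1.
  have : ccomp h (kk e) ~h czero _ _.
    apply: hk; first exact: leq_trans l0 ln.
    by apply: Kosz_noniso; [exact: leq_trans l0 ln | rewrite neq_ltn ltnSn].
  move=> /(ks_null hDVR)[c [c']]; rewrite /= /mklin_fun mul1r => ->.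
  exists 0, (c * x ^+ (n - l) + c'); rewrite mul0r add0r mulrDl.
  by rewrite -expx_split.
have e : 1 * x ^+ n.+2 = x ^+ n.+1 * x by rewrite mul1r exprSr.
have : ccomp h (kk e) ~h czero _ _.
  by apply: hk => //; apply: Kosz_noniso; rewrite // neq_ltn ltnSn orbT.
move=> /(ks_null hDVR)[c [c']]; rewrite /= /mklin_fun mul1r.
rewrite (regular_linear (f1 h)) => hx.
have x0 := DVR_not_field hDVR.
have {hx} hb : f1 h 1 = c * x ^+ n.+1 + c' * x ^+ (l - n.+1) * x ^+ n.
  apply: (mulfI x0); rewrite hx -mulrA -exprD.
  have -> : (l - n.+1 + n)%N = l.-1.
    by case: (l) nl => // m nm; rewrite subSS subnK.
  by rewrite -{1}(prednK l0) !exprS; ring.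
have [ln|nl'] := eqVneq l n.+1; last first.
  case: hn; apply/(ks_null hDVR); exists (c + c' * x ^+ (l - n.+2)), 0.
  rewrite mul0r addr0 hb mulrDl; congr (_ + _).
  have nl2 : (n.+1 < l)%N by rewrite ltn_neqAle eq_sym nl'.
  by rewrite -(subnSK nl2) !exprS; ring.
subst l; rewrite subnn mulr1 in hb.
(* The scalar of h is now (cx + c') x^n; a factor in (x) would make h null. *)
have [wu|[d wd]] := unit_or_multiple hDVR (c * x + c').
  have e' : (c * x + c') * x ^+ n.+1 = x ^+ n.+1 * (c * x + c') by rewrite mulrC.
  exists (kk e'); split; first by apply: (kk_iso hDVR); rewrite /= /mklin_fun mul1r.
  apply: eq_homotopic => t; rewrite /= /mklin_fun.
    by rewrite mulr0 mul0r (regular_linear (f0 h)) ks_coef // mulr0.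
  by rewrite (regular_linear (f1 h)) hb exprS; ring.
case: hn; apply/(ks_null hDVR); exists d, 0.
by rewrite mul0r addr0 hb !exprS [d * _]mulrA -wd; ring.
Qed.

(** Rules out AR-triangles from K(l)[1] to K(n+1), whose connecting map would land in K(l)[2], that
    is K(l). The map K(l)[1] -> K(n+1) with scalar 1 already detects every nonzero h. *)
Lemma no_even_connecting n l (h : cmap (K n.+1) (K l)) : (0 < l)%N ->
  ~ (h ~h czero _ _) ->
  ~ (forall j (t : cmap (shift (K j)) (K n.+1)), (0 < j)%N -> ~ is_iso t ->
    ccomp h t ~h czero _ _).
Proof.
move=> l0 hn hk; apply: hn; apply/(kk_null0 hDVR).
have : ccomp h (sk x l n.+1 1) ~h czero _ _.
  by apply: hk => //; exact: shift_Kosz_noniso.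
move=> /(sk_null hDVR)[c [c']]; rewrite /= /mklin_fun mul1r => ->.
by exists (c + c'); rewrite mulrDl.
Qed.

Lemma std_triangle_AR n : AR_triangle (std_triangle x n).
Proof.
have iK := Kvertex_indecomposable hDVR hcomplete hres false (ltn0Sn n).
split=> //=; first exact: std_triangle_exact.
  move=> /(ks_null hDVR)[c [c']]; rewrite /= /mklin_fun mul1r -mulrDl.
  move=> e; have := valuation_le hDVR (unitr1 A) (_ : 1 * x ^+ n = _).
  by rewrite mul1r => /(_ _ _ e); rewrite ltnn.
move=> D t /(indecomposableP hDVR hcomplete hres)[e [i [i0 [f [g [gf fg]]]]]] nt.
have H : ccomp (ks x n.+1 n.+1 (x ^+ n)) (ccomp t g) ~h czero _ _.
  apply: std_connecting_kills => it; apply: nt.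
  have -> : t ~h ccomp (ccomp t g) f by rewrite -ccompA gf ccompf1.
  by apply: comp_iso => //; exists g.
by rewrite -(ccompf1 t) -gf !ccompA -(ccompA _ t) H ccomp0f.
Qed.

Lemma AR_triangle_Kosz (T : triangle A) n :
  AR_triangle T -> isomorphic (K n.+1) (tM T) -> triangle_iso (std_triangle x n) T.
Proof.
move=> [eT iM iN hT aT] [f fi]; have [g [gf fg]] := fi.
have [e [l [l0 [q [q' [q'q qq']]]]]] := (indecomposableP hDVR hcomplete hres _).1 iN.
pose h := ccomp (ccomp (shift_map q) (th T)) f.
have hn : ~ (h ~h czero _ _).
  move=> h0; apply: hT.
  rewrite -(ccompf1 (th T)) -fg -(ccomp1f (th T)) -shift_map_id -q'q shift_map_comp.
  have -> : ccomp (ccomp (ccomp (shift_map q') (shift_map q)) (th T)) (ccomp f g) ~h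
    ccomp (shift_map q') (ccomp h g) by exact: eq_homotopic.
  by rewrite h0 ccomp0f ccompf0.
have hk e' j (t : cmap (Kvertex x e' j) (K n.+1)) : (0 < j)%N -> ~ is_iso t ->
    ccomp h t ~h czero _ _.
  move=> j0 nt; have H : ccomp (th T) (ccomp f t) ~h czero _ _.
    apply: aT; first exact: (Kvertex_indecomposable hDVR hcomplete hres).
    move=> ft; apply: nt; have -> : t ~h ccomp g (ccomp f t).
      by rewrite ccompA gf ccomp1f.
    by apply: comp_iso => //; exists f.
  by rewrite /h -!ccompA H ccompf0.
(* The first case is a triangle starting at K(l)[1]; it is excluded after identifying K(l)[2] with
   K(l). *)
case: e q q' q'q qq' @h hn hk => q q' q'q qq' h hn hk.
  have [s [sK Ks]] := shift2_iso (K l).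
  case: (@no_even_connecting n l (ccomp s h) l0) => [sh0|j t j0 nt].
    by apply: hn; rewrite -(ccomp1f h) -Ks -ccompA sh0 ccompf0.
  by rewrite -ccompA (hk true) // ccompf0.
have [p [ip ph]] := connecting_unique l0 hn (hk false).
apply: (@exact_fill_iso _ (std_triangle x n) T (ccomp q' p) f) => //.
- exact: std_triangle_exact.
- by apply: comp_iso => //; exists q.
- rewrite /= shift_map_comp -ccompA ph /h !ccompA -shift_map_comp q'q.
  by rewrite shift_map_id ccomp1f.
Qed.

(** Used to remove the contractible K(0) from the middle term, and to exchange the shift of a direct
    sum for the direct sum of the shifts. *)
Lemma AR_change_middle (T : triangle A) (E : complex2 A) (q : cmap (tE T) E) :
  AR_triangle T -> is_iso q -> exists (a : cmap (tN T) E) (b : cmap E (tM T)),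
    AR_triangle (Triangle a b (th T)) /\ triangle_iso T (Triangle a b (th T)).
Proof.
move=> [eT iM iN hT aT] qi; have [q' [q'q qq']] := qi.
exists (ccomp q (ta T)), (ccomp (tb T) q').
have TT : triangle_iso T (Triangle (ccomp q (ta T)) (ccomp (tb T) q') (th T)).
  exists (cid _), q, (cid _); split; first by split => //; exact: id_iso.
  split=> /=; first by rewrite ccompf1.
    by rewrite ccomp1f -ccompA q'q ccompf1.
  by rewrite shift_map_id ccomp1f ccompf1.
by split=> //; split=> //; exact: exact_triangle_iso TT eT.
Qed.

(* Indexed so that the AR-triangle ends at the vertex n.+1. *)
Definition middle e n : complex2 A :=
  if n is m.+1 then dsum (Kvertex x e m.+1) (Kvertex x e m.+3) else Kvertex x e 2.

Lemma AR_form_middle e n :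
  AR_form x (Kvertex x e n.+1) (middle e n) (Kvertex x e n.+1).
Proof.
case: n => [|m]; first by case: e; [exact: AR_form_shift_1 | exact: AR_form_1].
case: e; first exact: (@AR_form_shift_i _ _ m.+2).
exact: (@AR_form_i _ _ m.+2).
Qed.

Lemma AR_formP N E M : AR_form x N E M -> exists e n,
  [/\ N = Kvertex x e n.+1, E = middle e n & M = Kvertex x e n.+1].
Proof.
case=> [|[|[|i]] // _||[|[|i]] // _].
- by exists false, 0%N.
- by exists false, i.+1.
- by exists true, 0%N.
- by exists true, i.+1.
Qed.

Definition std_AR e n : triangle A :=
  if e then shift_triangle (std_triangle x n) else std_triangle x n.

Lemma std_AR_AR e n : AR_triangle (std_AR e n).
Proof. by case: e; [apply: shift_triangle_AR|]; exact: std_triangle_AR. Qed.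

Lemma middle_iso e n : exists q : cmap (tE (std_AR e n)) (middle e n), is_iso q.
Proof.
have H m : isomorphic (dsum (K m) (K m.+2)) (middle false m).
  case: m => [|m]; last exact: isomorphic_refl.
  by exists (dsnd _ _); apply: dsum_zero_l_iso; exact: Kosz0_zero.
case: e; last exact: H.
have /isomorphic_shift Hs := H n; apply: isomorphic_trans Hs _.
case: n => [|m]; first exact: isomorphic_refl.
by exists (shift_dsum _ _); exact: shift_dsum_iso.
Qed.

Lemma AR_triangle_exists e n : exists (a : cmap (Kvertex x e n.+1) (middle e n))
    (b : cmap (middle e n) (Kvertex x e n.+1))
    (h : cmap (Kvertex x e n.+1) (shift (Kvertex x e n.+1))),
  AR_triangle (Triangle a b h) /\ triangle_iso (std_AR e n) (Triangle a b h).
Proof.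
have [q qi] := middle_iso e n.
have [a [b [abAR iab]]] := AR_change_middle (std_AR_AR e n) qi.
(* Only for a concrete value of e do the outer terms of [std_AR] reduce to the vertices. *)
by case: e q qi a b abAR iab => q qi a b abAR iab; exists a, b; eexists; split; eassumption.
Qed.

Lemma AR_triangle_unique (T : triangle A) e n : AR_triangle T ->
  isomorphic (Kvertex x e n.+1) (tM T) -> triangle_iso T (std_AR e n).
Proof.
move=> arT; case: e => MT; apply: triangle_iso_sym; last exact: AR_triangle_Kosz.
have sT := shift_triangle_AR arT.
have : triangle_iso (std_triangle x n) (shift_triangle T).
  apply: AR_triangle_Kosz sT _; apply: isomorphic_trans (isomorphic_shift2 _) _.
  exact/isomorphic_shift.
move/shift_triangle_iso/triangle_iso_trans; apply.
exact: triangle_iso_sym (shift_triangle2 T).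
Qed.

Lemma AR_triangle_classification (T : triangle A) : AR_triangle T ->
  exists e n, isomorphic (Kvertex x e n.+1) (tM T) /\ triangle_iso T (std_AR e n).
Proof.
move=> arT; have [_ iM _ _ _] := arT.
have [e [[|n] [// _ Mi]]] := (indecomposableP hDVR hcomplete hres _).1 iM.
exists e, n; have MT := isomorphic_sym Mi; split=> //.
exact: AR_triangle_unique.
Qed.

End Classification.

(** * Multiplicities and irreducible maps *)

Section Multiplicity.
Variables (A : idomainType) (x : A) (k : closedFieldType) (rho : {rmorphism A -> k}).
Hypotheses (hDVR : is_DVR x) (hcomplete : adically_complete x).
Hypothesis hres : is_residue_map x rho.
Variables (e : bool) (i : nat).
Hypothesis i0 : (0 < i)%N.

Notation Z := (Kvertex x e i).

Definition resid_mx (X : complex2 A) m (v : 'I_m -> cmap X Z) (u : 'I_m -> cmap Z X)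
  : 'M[k]_m := \matrix_(a, b) resid rho (ccomp (v a) (u b)).

Lemma resid_eq (f g : cmap Z Z) : f ~h g -> resid rho f = resid rho g.
Proof. exact: resid_homotopic. Qed.

Lemma resid_through_other (W : complex2 A) (v : cmap W Z) (u : cmap Z W) :
  indecomposable W -> ~ isomorphic W Z -> resid rho (ccomp v u) = 0.
Proof.
move=> /(indecomposableP hDVR hcomplete hres)[e' [j [_ [f [g [gf fg]]]]]] nWZ.
apply/eqP; apply: contrapT => /negP.
have -> : resid rho (ccomp v u) = resid rho (ccomp (ccomp v g) (ccomp f u)).
  by apply: resid_eq; rewrite -ccompA (ccompA g) gf ccomp1f.
move=> /(resid_through hDVR hres)[ee ij]; apply: nWZ; subst.
by exists f, g.
Qed.

(** The residue matrix is a sum over the summands W. One isomorphic to Z contributes a column times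
    a row, of rank at most 1; any other contributes zero by [resid_through_other]. *)
Lemma resid_mx_rank (s : seq (complex2 A)) m
    (v : 'I_m -> cmap (big_dsum s) Z) (u : 'I_m -> cmap Z (big_dsum s)) :
  all (fun W => `[< indecomposable W >]) s ->
  (\rank (resid_mx v u) <= count (fun W => `[< isomorphic W Z >]) s)%N.
Proof.
elim: s v u => [|W s IH] v u /=.
  move=> _; suff -> : resid_mx v u = 0 by rewrite mxrank0.
  apply/matrixP => a b; rewrite !mxE -(resid0 x rho e i).
  apply: resid_eq; rewrite (is_zero_source (v a) (@zero_complex_is_zero A)).
  exact: ccomp0f.
case/andP=> /asboolP iW sI.
have -> : resid_mx v u =
    resid_mx (fun a => ccomp (v a) (dinl _ _)) (fun b => ccomp (dfst _ _) (u b)) +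
    resid_mx (fun a => ccomp (v a) (dinr _ _)) (fun b => ccomp (dsnd _ _) (u b)).
  by apply/matrixP => a b; rewrite !mxE -resid_add; apply: resid_eq; exact: dsum_comp.
apply: leq_trans (mxrank_add _ _) _; apply: leq_add; last exact: IH.
case: asboolP => [[f [g [gf fg]]]|nWZ].
  pose c := \col_a resid rho (ccomp (ccomp (v a) (dinl _ _)) g).
  pose r := \row_b resid rho (ccomp f (ccomp (dfst _ _) (u b))).
  suff -> : resid_mx (fun a => ccomp (v a) (dinl _ _))
      (fun b => ccomp (dfst _ _) (u b)) = c *m r.
    by apply: leq_trans (mxrankM_maxl _ _) _; exact: rank_leq_col.
  apply/matrixP => a b; rewrite !mxE big_ord1 !mxE -resid_comp.
  apply: resid_eq; rewrite -[X in _ ~h X]ccompA (ccompA g) gf ccomp1f.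
  reflexivity.
suff -> : resid_mx (fun a => ccomp (v a) (dinl W (big_dsum s)))
    (fun b => ccomp (dfst _ _) (u b)) = 0 by rewrite mxrank0.
by apply/matrixP => a b; rewrite !mxE; exact: resid_through_other.
Qed.

Lemma resid_mx_full (s : seq (complex2 A)) :
  exists (v : 'I_(count (fun W => `[< isomorphic W Z >]) s) -> cmap (big_dsum s) Z)
         (u : 'I_(count (fun W => `[< isomorphic W Z >]) s) -> cmap Z (big_dsum s)),
    resid_mx v u = 1%:M.
Proof.
elim: s => [|W s [v [u IH]]] /=.
  by exists (fun=> czero _ _), (fun=> czero _ _); apply/matrixP => -[].
have vu a b : resid rho (ccomp (v a) (u b)) = (a == b)%:R.
  by have /matrixP/(_ a b) := IH; rewrite !mxE.
case: asboolP => [[f [g [gf fg]]]|nWZ]; last first.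
  exists (fun a => ccomp (v a) (dsnd _ _)), (fun b => ccomp (dinr _ _) (u b)).
  apply/matrixP => a b; rewrite !mxE -vu; apply: resid_eq.
  by rewrite -ccompA (ccompA (dsnd _ _)) dsnd_inr ccomp1f.
set c := count _ s in v u IH vu *.
pose v' (a : 'I_(1 + c)) : cmap (dsum W (big_dsum s)) Z := match split a with
  | inl _ => ccomp f (dfst _ _) | inr a' => ccomp (v a') (dsnd _ _) end.
pose u' (a : 'I_(1 + c)) : cmap Z (dsum W (big_dsum s)) := match split a with
  | inl _ => ccomp (dinl _ _) g | inr a' => ccomp (dinr _ _) (u a') end.
exists v', u'; apply/matrixP => a b; rewrite !mxE /v' /u'.
rewrite -val_eqE /=; case: (splitP a) => a' ->; case: (splitP b) => b' ->.
- rewrite !ord1 eqxx -(resid_id x rho e i); apply: resid_eq.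
  by rewrite -ccompA (ccompA (dfst _ _)) dfst_inl ccomp1f.
- rewrite ord1 add1n mulr0n -(resid0 x rho e i); apply: resid_eq.
  by rewrite -ccompA (ccompA (dfst _ _)) dfst_inr ccomp0f ccompf0.
- rewrite ord1 add1n mulr0n -(resid0 x rho e i); apply: resid_eq.
  by rewrite -ccompA (ccompA (dsnd _ _)) dsnd_inl ccomp0f ccompf0.
- rewrite eqn_add2l val_eqE -vu; apply: resid_eq.
  by rewrite -ccompA (ccompA (dsnd _ _)) dsnd_inr ccomp1f.
Qed.

(** The projections to and inclusions of the copies of Z in s have the identity as residue matrix.
    The isomorphism turns it into a residue matrix for s', where its rank is bounded by the
    multiplicity. *)
Lemma multiplicity_le (s s' : seq (complex2 A)) :
  all (fun W => `[< indecomposable W >]) s' ->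
  isomorphic (big_dsum s) (big_dsum s') ->
  (count (fun W => `[< isomorphic W Z >]) s <=
   count (fun W => `[< isomorphic W Z >]) s')%N.
Proof.
move=> sI' [f [g [gf fg]]]; have [v [u vu]] := resid_mx_full s.
rewrite -(mxrank1 k (count _ s)) -vu.
have -> : resid_mx v u = resid_mx (fun a => ccomp (v a) g) (fun b => ccomp f (u b)).
  apply/matrixP => a b; rewrite !mxE; apply: resid_eq.
  by rewrite -ccompA (ccompA g) gf ccomp1f.
exact: resid_mx_rank.
Qed.

End Multiplicity.

(** * Irreducible maps between the vertices *)

Section Irreducible.
Variables (A : idomainType) (x : A) (k : closedFieldType) (rho : {rmorphism A -> k}).
Hypotheses (hDVR : is_DVR x) (hcomplete : adically_complete x).
Hypothesis hres : is_residue_map x rho.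

Notation K i := (Kosz x i).

(** Given a factorization of f through W, decompose W into vertices. By additivity some summand
    contributes a nonzero value of [lam]; there one of the two components splits, and so does the
    corresponding factor of f. *)
Lemma irreducible_by_functional (Z M : complex2 A) (lam : cmap Z M -> k) :
  (forall f g, f ~h g -> lam f = lam g) -> lam (czero Z M) = 0 ->
  (forall f g, lam (cadd f g) = lam f + lam g) ->
  (forall e j (g : cmap Z (Kvertex x e j)) (h : cmap (Kvertex x e j) M),
    lam (ccomp h g) != 0 -> split_mono g \/ split_epi h) ->
  forall f, ~ split_mono f -> ~ split_epi f -> lam f != 0 -> irreducible_map f.
Proof.
move=> lamH lam0 lamD lamV f nm ne lf; split=> // W g h KW fhg.
have [s [_ [p [q [qp pq]]]]] := decomposition hDVR hcomplete KW.
suff H : forall (g' : cmap Z (vertex_sum x s)) (h' : cmap (vertex_sum x s) M),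
    lam (ccomp h' g') != 0 -> split_mono g' \/ split_epi h'.
  have [|[r rg]|[r rh]] := H (ccomp p g) (ccomp h q).
  - rewrite -(lamH f) // fhg -ccompA (ccompA q) qp ccomp1f; reflexivity.
  - by left; exists (ccomp r p); rewrite -ccompA.
  - by right; exists (ccomp q r); rewrite ccompA.
elim: s {p q qp pq} => [|[e j] s IH] g' h' hg.
  case/eqP: hg; rewrite -lam0; apply: lamH.
  by rewrite (is_zero_source h' (@zero_complex_is_zero A)) ccomp0f.
move: hg; rewrite (lamH _ _ (dsum_comp h' g')) lamD.
have [->|/lamV H _] := eqVneq (lam (ccomp (ccomp h' (dinl _ _)) (ccomp (dfst _ _) g'))) 0.
  rewrite add0r => /IH[[r rg]|[r rh]].
    by left; exists (ccomp r (dsnd _ _)); rewrite -ccompA.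
  by right; exists (ccomp (dinr _ _) r); rewrite ccompA.
case: H => [[r rg]|[r rh]].
  by left; exists (ccomp r (dfst _ _)); rewrite -ccompA.
by right; exists (ccomp (dinl _ _) r); rewrite ccompA.
Qed.

Lemma Kvertex_nonsplit e i e' j (f : cmap (Kvertex x e i) (Kvertex x e' j)) :
  (0 < i)%N -> (0 < j)%N -> (e, i) <> (e', j) -> ~ split_mono f /\ ~ split_epi f.
Proof.
move=> i0 j0 ij; split=> -[r rf]; apply: ij.
  by have [-> ->] := Kvertex_retract hDVR hres i0 rf.
by have [-> ->] := Kvertex_retract hDVR hres j0 rf.
Qed.

Fact up_eq i : x * x ^+ i = x ^+ i.+1 * 1.
Proof. by rewrite mulr1 exprS. Qed.
Fact down_eq i : 1 * x ^+ i.+1 = x ^+ i * x.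
Proof. by rewrite mul1r exprSr. Qed.

Lemma kk_unit_le i j (f : cmap (K i) (K j)) :
  (f0 f 1 \is a GRing.unit -> (j <= i)%N) /\ (f1 f 1 \is a GRing.unit -> (i <= j)%N).
Proof.
have fc := kk_coef f; split=> fu.
  by apply: (valuation_le hDVR fu (c := f1 f 1)); rewrite fc mulrC.
by apply: (valuation_le hDVR fu (c := f0 f 1)); rewrite fc mulrC.
Qed.

Lemma kk_iso1 i (f : cmap (K i) (K i)) : f1 f 1 \is a GRing.unit -> is_iso f.
Proof.
move=> fu; apply: (kk_iso hDVR); rewrite (_ : f0 f 1 = f1 f 1) //.
by apply: (expx_inj_r hDVR (n := i)); rewrite kk_coef mulrC.
Qed.

(** The functional is the residue of the odd scalar. If it is nonzero on a composite through K(j),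
    both odd scalars are units, so i <= j <= i+1 and one of the factors is an isomorphism; through
    K(j)[1] it vanishes. *)
Lemma irreducible_up i : (0 < i)%N -> irreducible_map (kk (up_eq i)).
Proof.
move=> i0; have [|nm ne] := @Kvertex_nonsplit false i false i.+1 (kk (up_eq i)) i0 isT.
  by case=> /eqP; rewrite -[i in i == _]addn0 -addn1 eqn_add2l.
pose lam (f : cmap (K i) (K i.+1)) := rho (f1 f 1).
apply: (@irreducible_by_functional (K i) (K i.+1) lam _ _ _ _ (kk (up_eq i)));
  rewrite /lam => //.
- move=> f g /csub_homotopic0/(kk_null1 hDVR)[c /= fc]; apply/eqP.
  by rewrite -subr_eq0 -rmorphB fc (rho_multiple_exp hres).
- by rewrite /= rmorph0.
- by move=> f g; rewrite /= rmorphD.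
- move=> [] j g h /=.
    by rewrite (regular_linear (f1 h)) (sk_coef hDVR h) mulr0 rmorph0 eqxx.
  rewrite (regular_linear (f1 h)) rmorphM mulf_eq0 negb_or.
  case/andP=> /(rho_unit hDVR hres) gu /(rho_unit hDVR hres) hu.
  have ij := (kk_unit_le g).2 gu; have ji := (kk_unit_le h).2 hu.
  have /orP[/eqP e|/eqP e] : (j == i) || (j == i.+1) by lia.
    by left; apply: iso_split_mono; move: g gu {h hu}; rewrite e => g; exact: kk_iso1.
  by right; apply: iso_split_epi; move: h hu {g gu}; rewrite e => h; exact: kk_iso1.
- by rewrite /= /mklin_fun mulr1 rmorph1 oner_neq0.
Qed.

(** Here the even scalar is tested, because the odd scalar of a map K(i+1) -> K(i) is divisible by
    x. *)
Lemma irreducible_down i : (0 < i)%N -> irreducible_map (kk (down_eq i)).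
Proof.
move=> i0; have [|nm ne] := @Kvertex_nonsplit false i.+1 false i (kk (down_eq i)) isT i0.
  by case=> /esym/eqP; rewrite -[i in i == _]addn0 -addn1 eqn_add2l.
pose lam (f : cmap (K i.+1) (K i)) := rho (f0 f 1).
apply: (@irreducible_by_functional (K i.+1) (K i) lam _ _ _ _ (kk (down_eq i)));
  rewrite /lam => //.
- move=> f g /csub_homotopic0/(kk_null0 hDVR)[c /= fc]; apply/eqP.
  by rewrite -subr_eq0 -rmorphB fc (rho_multiple_exp hres).
- by rewrite /= rmorph0.
- by move=> f g; rewrite /= rmorphD.
- move=> [] j g h /=.
    by rewrite (ks_coef hDVR g) linear0 rmorph0 eqxx.
  rewrite (regular_linear (f0 h)) rmorphM mulf_eq0 negb_or.
  case/andP=> /(rho_unit hDVR hres) gu /(rho_unit hDVR hres) hu.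
  have ij := (kk_unit_le g).1 gu; have ji := (kk_unit_le h).1 hu.
  have /orP[/eqP e|/eqP e] : (j == i) || (j == i.+1) by lia.
    by right; apply: iso_split_epi; move: h hu {g gu}; rewrite e => h; exact: (kk_iso hDVR).
  by left; apply: iso_split_mono; move: g gu {h hu}; rewrite e => g; exact: (kk_iso hDVR).
- by rewrite /= /mklin_fun mulr1 rmorph1 oner_neq0.
Qed.

Lemma irreducible_unshift (X Y : complex2 A) (f : cmap (shift X) (shift Y)) :
  irreducible_map f -> irreducible_map (unshift f).
Proof.
move=> [nm ne irr]; split.
- move=> /shift_map_split_mono [r rf]; apply: nm; exists r.
  by rewrite -(unshiftK f).
- move=> /shift_map_split_epi [r rf]; apply: ne; exists r.
  by rewrite -(unshiftK f).
- move=> W g h KW fhg.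
  have [||H|H] := irr _ (shift_map g) (shift_map h); first exact/in_Kf_shift.
  + by rewrite -(unshiftK f) -shift_map_comp fhg.
  + by left; apply/shift_map_split_mono.
  + by right; apply/shift_map_split_epi.
Qed.

Lemma irreducible_shift (X Y : complex2 A) (f : cmap X Y) :
  irreducible_map f -> irreducible_map (shift_map f).
Proof.
move=> [nm ne irr]; split; [by move/shift_map_split_mono | by move/shift_map_split_epi |].
move=> W; have [W' <-] := shift_surj W => g h /in_Kf_shift KW fhg.
have [|/shift_map_split_mono[r rg]|/shift_map_split_epi[r rh]] :=
  irr _ (unshift g) (unshift h) KW.
- by apply: shift_map_inj; rewrite fhg shift_map_comp !unshiftK.
- by left; exists r; rewrite -(unshiftK g).
- by right; exists r; rewrite -(unshiftK h).
Qed.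

(** Every such map factors through K(i) -> K(i+1) with odd scalar 1, and neither factor splits since
    its ends are different vertices. *)
Lemma not_irreducible_ks i j (f : cmap (K i) (shift (K j))) :
  (0 < i)%N -> (0 < j)%N -> ~ irreducible_map f.
Proof.
move=> i0 j0 [_ _ irr].
have [||H|H] := irr (K i.+1) (kk (up_eq i)) (ks x i.+1 j (f1 f 1)).
- exact: in_Kf_Kosz.
- apply: eq_homotopic => t; rewrite /= /mklin_fun.
    by rewrite (regular_linear (f0 f)) (ks_coef hDVR) !mulr0.
  by rewrite (regular_linear (f1 f)) mulr1.
- have [|nmu _] := @Kvertex_nonsplit false i false i.+1 (kk (up_eq i)) i0 isT.
    by move=> [ii]; lia.
  exact: nmu.
- have [//|_ nes] := @Kvertex_nonsplit false i.+1 true j (ks x i.+1 j (f1 f 1)) isT j0.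
  exact: nes.
Qed.

(** Otherwise f factors through a vertex different from both ends: K(i+1) if i < j, K(i-1) if i > j.
    For i = j a map that is not an isomorphism has its scalar in (x) and factors through K(i+1). *)
Lemma not_irreducible_kk i j (f : cmap (K i) (K j)) : (0 < i)%N -> (0 < j)%N ->
  irreducible_map f -> (j == i.+1) || (i == j.+1).
Proof.
move=> i0 j0 [nm ne irr]; apply: contrapT => /negP; rewrite negb_or => /andP[/eqP ji /eqP ij].
have fc := kk_coef f.
have ns a b (g : cmap (K a) (K b)) : [&& 0 < a, 0 < b & a != b]%N ->
    ~ split_mono g /\ ~ split_epi g.
  move=> /and3P[a0 b0 /eqP ab].
  by apply: (@Kvertex_nonsplit false a false b g a0 b0); case.
have [lt_ij|lt_ji|eij] := ltngtP i j.
- have fa : f0 f 1 = x ^+ (j - i) * f1 f 1.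
    apply: (expx_inj_r hDVR (n := i)); rewrite fc.
    by rewrite [LHS]mulrC (expx_split _ _ (ltnW lt_ij)); ring.
  have e : x ^+ (j - i.+1) * f1 f 1 * x ^+ i.+1 = x ^+ j * f1 f 1.
    by rewrite [RHS]mulrC (expx_split _ _ lt_ij); ring.
  have [||H|H] := irr (K i.+1) (kk (up_eq i)) (kk e).
  + exact: in_Kf_Kosz.
  + apply: eq_homotopic => t; rewrite /= /mklin_fun.
      by rewrite (regular_linear (f0 f)) fa -(subnSK lt_ij) exprS !mulrA.
    by rewrite (regular_linear (f1 f)) mulr1.
  + by have [|nmu _] := ns _ _ (kk (up_eq i)); [lia | exact: nmu].
  + by have [|_ nes] := ns _ _ (kk e); [lia | exact: nes].
- case: i i0 f nm ne irr ji ij fc lt_ji => // i _ f nm ne irr ji ij fc lt_ji.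
  have fb : f1 f 1 = x ^+ (i.+1 - j) * f0 f 1.
    apply: (mulfI (expx_neq0 hDVR j)); rewrite -fc.
    by rewrite (expx_split _ _ (ltnW lt_ji)); ring.
  have e : (f0 f 1 : A) * x ^+ i = x ^+ j * (x ^+ (i - j) * f0 f 1).
    by rewrite (expx_split _ _ (lt_ji : (j <= i)%N)); ring.
  have [||H|H] := irr (K i) (kk (down_eq i)) (kk e).
  + exact: in_Kf_Kosz.
  + apply: eq_homotopic => t; rewrite /= /mklin_fun.
      by rewrite (regular_linear (f0 f)) mulr1.
    by rewrite (regular_linear (f1 f)) fb (subSn (lt_ji : (j <= i)%N)) exprS !mulrA.
  + by have [|nmu _] := ns _ _ (kk (down_eq i)); [lia | exact: nmu].
  + by have [|_ nes] := ns _ _ (kk e); [lia | exact: nes].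
- subst j; have [fu|[c fx]] := unit_or_multiple hDVR (f0 f 1).
    by apply: nm; apply: iso_split_mono; exact: (kk_iso hDVR fu).
  have fb : f1 f 1 = f0 f 1.
    by apply: (expx_inj_r hDVR (n := i)); rewrite fc mulrC.
  have e : c * x ^+ i.+1 = x ^+ i * (c * x) by rewrite exprS; ring.
  have [||H|H] := irr (K i.+1) (kk (up_eq i)) (kk e).
  + exact: in_Kf_Kosz.
  + apply: eq_homotopic => t; rewrite /= /mklin_fun.
      by rewrite (regular_linear (f0 f)) fx -mulrA (mulrC c).
    by rewrite (regular_linear (f1 f)) fb fx mulr1.
  + by have [|nmu _] := ns _ _ (kk (up_eq i)); [lia | exact: nmu].
  + by have [|_ nes] := ns _ _ (kk e); [lia | exact: nes].
Qed.

Lemma irreducible_KvertexP e e' i j : (0 < i)%N -> (0 < j)%N ->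
  (exists f : cmap (Kvertex x e i) (Kvertex x e' j), irreducible_map f) <->
  (e == e') && ((j == i.+1) || (i == j.+1)).
Proof.
move=> i0 j0; split=> [[f fi]|].
  case: e e' f fi => [] [] f fi.
  - exact: not_irreducible_kk i0 j0 (irreducible_unshift fi).
  (* With K(j) written as K(j)[2], a map K(i)[1] -> K(j) is the shift of a map K(i) -> K(j)[1]. *)
  - move: f fi; rewrite /Kvertex -[K j]shiftK => f /irreducible_unshift.
    by move/not_irreducible_ks => /(_ i0 j0).
  - by case: (not_irreducible_ks i0 j0 fi).
  - exact: not_irreducible_kk fi.
case/andP=> /eqP <-; have H : (j == i.+1) || (i == j.+1) ->
    exists f : cmap (K i) (K j), irreducible_map f.
  case/orP=> /eqP eij; subst.
    by exists (kk (up_eq i)); exact: irreducible_up.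
  by exists (kk (down_eq j)); exact: irreducible_down.
case: e => /H // -[f fi]; exists (shift_map f); exact: irreducible_shift.
Qed.

End Irreducible.

(** * Multiplicities in the middle terms *)

Section MultiplicityFormula.
Variables (A : idomainType) (x : A) (k : closedFieldType) (rho : {rmorphism A -> k}).
Hypotheses (hDVR : is_DVR x) (hcomplete : adically_complete x).
Hypothesis hres : is_residue_map x rho.

(** Indexed like [middle]: these are the indices adjacent to n+1, without 0. *)
Definition neighbours n : seq nat := if n is m.+1 then [:: m.+1; m.+3] else [:: 2].

Lemma middle_vertex_sum e n :
  isomorphic (middle x e n) (big_dsum [seq Kvertex x e j | j <- neighbours n]).
Proof.
have H Y : isomorphic Y (dsum Y (zero_complex A)).
  apply: isomorphic_sym; exists (dfst _ _); apply: dsum_zero_r_iso.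
  exact: zero_complex_is_zero.
case: n => [|m]; first exact: H.
by apply: isomorphic_dsum; [exact: isomorphic_refl | exact: H].
Qed.

Lemma neighbours_indecomposable e n :
  all (fun W => `[< indecomposable W >]) [seq Kvertex x e j | j <- neighbours n].
Proof.
have H m : (0 < m)%N -> `[< indecomposable (Kvertex x e m) >].
  by move=> m0; apply/asboolP; exact: (Kvertex_indecomposable hDVR hcomplete hres).
by case: n => [|n] /=; rewrite !H.
Qed.

Lemma count_neighbours e e' i n : (0 < i)%N ->
  count (fun W => `[< isomorphic W (Kvertex x e i) >])
    [seq Kvertex x e' j | j <- neighbours n] =
  ((e == e') && ((n.+1 == i.+1) || (i == n.+2)))%N.
Proof.
move=> i0; have H m : (0 < m)%N ->
    `[< isomorphic (Kvertex x e' m) (Kvertex x e i) >] = (e == e') && (m == i).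
  move=> m0; apply/asboolP/andP => [H|[/eqP <- /eqP <-]]; last exact: isomorphic_refl.
  by have [-> ->] := Kvertex_inj hDVR hres m0 H.
case: n => [|n] /=; rewrite !H //; first by case: eqP => _ /=; lia.
by case: eqP => _ /=; lia.
Qed.

(** The explicit triangle realizes the count. Any other AR-triangle with this end term is isomorphic
    to the standard one, so the two decompositions of the middle term are compared by
    [multiplicity_le] in both directions. *)
Lemma irr_multP e e' i j m : (0 < i)%N -> (0 < j)%N ->
  irr_mult (Kvertex x e i) (Kvertex x e' j) m <->
  m = ((e == e') && ((j == i.+1) || (i == j.+1)))%N.
Proof.
case: j => // n i0 _; rewrite -(count_neighbours e e' n i0); split; last first.
  move=> ->; have [a [b [h [abh _]]]] := AR_triangle_exists hDVR hcomplete hres e' n.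
  exists (Triangle a b h); split=> //.
  exists [seq Kvertex x e' j | j <- neighbours n]; split=> //.
    exact: neighbours_indecomposable.
  exact: middle_vertex_sum.
move=> [T [arT MT [s [sI Es <-]]]].
have TS : triangle_iso T (std_AR x e' n).
  apply: (AR_triangle_unique hDVR hcomplete hres) => //.
  by rewrite MT; exact: isomorphic_refl.
have EE : isomorphic (tE T) (big_dsum [seq Kvertex x e' j | j <- neighbours n]).
  have [_ [q [_ [[_ qi _] _]]]] := TS; apply: (isomorphic_trans (ex_intro _ q qi)).
  have [q' q'i] := middle_iso x e' n.
  apply: (isomorphic_trans (ex_intro _ q' q'i)); exact: middle_vertex_sum.
apply/eqP; rewrite eqn_leq; apply/andP; split.
  apply: (multiplicity_le hDVR hcomplete hres e i0).
    exact: neighbours_indecomposable.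
  exact: isomorphic_trans (isomorphic_sym Es) EE.
apply: (multiplicity_le hDVR hcomplete hres e i0) => //.
exact: isomorphic_trans (isomorphic_sym EE) Es.
Qed.

End MultiplicityFormula.

Theorem theorem12p6 (A : idomainType) (x : A)
    (k : closedFieldType) (rho : {rmorphism A -> k})
    (hDVR : is_DVR x) (hcomplete : adically_complete x)
    (hres : is_residue_map x rho) :
  (* (1) *)
  ((forall N E M : complex2 A, AR_form x N E M ->
      exists (a : cmap N E) (b : cmap E M) (h : cmap M (shift N)),
        AR_triangle (Triangle a b h)) /\
   (forall T : triangle A, AR_triangle T ->
      exists (N E M : complex2 A)
             (a : cmap N E) (b : cmap E M) (h : cmap M (shift N)),
        [/\ AR_form x N E M, AR_triangle (Triangle a b h) &
            triangle_iso T (Triangle a b h)])) /\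
  (* (2), vertices *)
  ((forall X : complex2 A, indecomposable X <->
      exists (e : bool) (i : nat), (1 <= i)%N /\ isomorphic X (Kvertex x e i)) /\
   (forall (e e' : bool) (i j : nat), (1 <= i)%N -> (1 <= j)%N ->
      isomorphic (Kvertex x e i) (Kvertex x e' j) -> e = e' /\ i = j)) /\
  (* (2), arrows *)
  (forall (e e' : bool) (i j : nat), (1 <= i)%N -> (1 <= j)%N ->
     (forall m : nat, irr_mult (Kvertex x e i) (Kvertex x e' j) m <->
        m = ((e == e') && ((j == i.+1) || (i == j.+1)))%N) /\
     ((exists f : cmap (Kvertex x e i) (Kvertex x e' j), irreducible_map f) <->
        (e == e') && ((j == i.+1) || (i == j.+1)))).
Proof.
split; [split|split; [split|]].
- move=> N E M /AR_formP[e [n [-> -> ->]]].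
  by have [a [b [h [abh _]]]] := AR_triangle_exists hDVR hcomplete hres e n; exists a, b, h.
- move=> T /(AR_triangle_classification hDVR hcomplete hres)[e [n [_ TS]]].
  have [a [b [h [abh iso]]]] := AR_triangle_exists hDVR hcomplete hres e n.
  exists (Kvertex x e n.+1), (middle x e n), (Kvertex x e n.+1), a, b, h; split=> //.
    exact: AR_form_middle.
  exact: triangle_iso_trans TS iso.
- exact: (indecomposableP hDVR hcomplete hres).
- by move=> e e' i j i0 _; exact: (Kvertex_inj hDVR hres i0).
- move=> e e' i j i0 j0; split=> [m|].
    exact: (irr_multP hDVR hcomplete hres).
  exact: (irreducible_KvertexP hDVR hcomplete hres).
Qed.
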